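(* Let $\boldsymbol\alpha\in\mathbb{N}^m$, $\boldsymbol\beta\in\mathbb{N}^n$ with $\sum_i\alpha_i=\sum_j\beta_j$, and assume $\alpha_i>0$ for $2\le i\le m$ and $\beta_j>0$ for $1\le j\le n$. Let $\mathcal{T}_{\boldsymbol\alpha,\boldsymbol\beta}\subset\mathbb{R}^{m\times n}$ be the transportation polytope of real $m\times n$ matrices $Z=(z_{ij})$ with $z_{ij}\ge0$, row sums $\sum_j z_{ij}=\alpha_i$ and column sums $\sum_i z_{ij}=\beta_j$, and let $\mathrm{Vol}$ denote its $(m-1)(n-1)$-dimensional Euclidean volume. Then \[ \mathrm{Vol}(\mathcal{T}_{\boldsymbol\alpha,\boldsymbol\beta})\ \ge\ \frac{\sqrt{m^{n-1}n^{m-1}}}{e^{m+n-1}}\prod_{i=2}^m\frac{1}{\alpha_i}\prod_{j=1}^n\frac1{\beta_j}\ \inf_{\mathbf{x}\in(0,1)^m,\ \mathbf{y}\in(0,1)^n}\ \prod_{i=1}^m x_i^{-\alpha_i}\prod_{j=1}^n y_j^{-\beta_j}\prod_{i=1}^m\prod_{j=1}^n\frac{-1}{\log(x_iy_j)}. \] *)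

(* Defs.v *)
From HB Require Import structures.
From mathcomp Require Import all_boot all_order all_algebra.
From mathcomp Require Import all_classical all_reals all_analysis.

Set Implicit Arguments.
Unset Strict Implicit.
Unset Printing Implicit Defensive.

Import Order.TTheory GRing.Theory Num.Theory.
Import numFieldNormedType.Exports.

Local Open Scope classical_set_scope.
Local Open Scope ring_scope.

Definition transportation_polytope (R : realType) (m n : nat)
    (alpha : 'I_m -> nat) (beta : 'I_n -> nat) : set 'M[R]_(m, n) :=
  [set Z | [/\ forall i j, 0 <= Z i j,
               forall i, \sum_(j < n) Z i j = (alpha i)%:R &
               forall j, \sum_(i < m) Z i j = (beta j)%:R]].

Definition closed_box (R : realType) (d : nat) (a b : 'rV[R]_d) :
    set 'rV[R]_d :=
  [set u | forall i, a 0 i <= u 0 i <= b 0 i].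

(* Countable covers are indexed by a subset [K] of [nat] rather than by the
   whole of [nat]: in dimension 0 every box is a point of volume 1, so a cover
   by infinitely many boxes would always have infinite total volume. *)
Definition lebesgue_outer (R : realType) (d : nat) (A : set 'rV[R]_d) :
    \bar R :=
  ereal_inf [set v | exists (K : set nat) (a b : nat -> 'rV[R]_d),
    [/\ forall k i, a k 0 i <= b k 0 i,
        A `<=` \bigcup_(k in K) closed_box (a k) (b k) &
        v = (\esum_(k in K) (\prod_(i < d) (b k 0 i - a k 0 i))%:E)%E]].

Definition affine_chart (R : realType) (d N : nat) (c : 'rV[R]_N)
    (B : 'M[R]_(d, N)) (u : 'rV[R]_d) : 'rV[R]_N := c + u *m B.

(* [d]-dimensional Euclidean volume of a set [S] contained in a
   [d]-dimensional affine subspace [c + rowspan B] of [R^N]: the Lebesgue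
   measure of [S] in the coordinates [u |-> c + u B], rescaled by the volume
   [sqrt (det (B B^T))] of the parallelotope spanned by the rows of [B] (which
   is 1 when they are orthonormal).  By the linear change of variables formula
   this does not depend on [c] and [B], so for such an [S] the supremum ranges
   over a single value.  On compact sets, such as polytopes, the outer measure
   is the Lebesgue measure. *)
Definition euclidean_volume (R : realType) (d N : nat) (S : set 'rV[R]_N) :
    \bar R :=
  ereal_sup [set v | exists (c : 'rV[R]_N) (B : 'M[R]_(d, N)),
    [/\ row_free B,
        S `<=` range (affine_chart c B) &
        v = ((Num.sqrt (\det (B *m B^T)))%:E *
             lebesgue_outer (affine_chart c B @^-1` S))%E]].

(* [mxvec] identifies m x n matrices with R^(m * n), so that the Euclidean
   structure is that of the Frobenius norm. *)
Definition transportation_volume (R : realType) (m n : nat)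
    (alpha : 'I_m -> nat) (beta : 'I_n -> nat) : \bar R :=
  euclidean_volume ((m - 1) * (n - 1))
    (mxvec @` @transportation_polytope R m n alpha beta).

Definition open_unit_cube (R : realType) (m : nat) : set ('I_m -> R) :=
  [set x | forall i, 0 < x i < 1].

(* Main.v *)
(* Let [F] be the volume of the slice of the nonnegative orthant with prescribed
   margins, as a function of all margins but one, and let [p] be the given margins.
   By the Prekopa-Leindler inequality every iterated integral of a log-concave
   function is log-concave, hence so is [F].  For a log-concave [g] vanishing on the
   negative half line, the supporting line of [ln g] at [p > 0] gives some [t] with
   [\int g q * exp (- t * (q - p)) dq <= e * p * g p].  Applying this to one margin
   after the other bounds the Laplace transform of [F] at some [t], multiplied by
   [exp (t * p)], by [e ^ (m + n - 1)] times the product of the margins times [F p].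
   By Tonelli that Laplace transform is the product over the entries of
   [\int_(z >= 0) exp (- (s_i + t_j) * z) dz = 1 / (s_i + t_j)], which is a value of
   the function under the infimum for [x_i = exp (- s_i)] and [y_j = exp (- t_j)];
   these are in (0, 1) after a shift of [s] and [t] in opposite directions.  The
   factor [sqrt (m ^ (n - 1) * n ^ (m - 1))] is the volume of the parallelotope
   spanned by the matrices [(e_i - e_0)^T (e_j - e_0)]. *)

Require Import Defs.
From HB Require Import structures.
From mathcomp Require Import all_boot all_order all_algebra.
From mathcomp Require Import all_classical all_reals all_analysis.
From mathcomp Require Import measurable_realfun mxtens ring lra.

Set Implicit Arguments.
Unset Strict Implicit.
Unset Printing Implicit Defensive.

Import Order.TTheory GRing.Theory Num.Theory.
Import numFieldNormedType.Exports.

Local Open Scope classical_set_scope.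
Local Open Scope ring_scope.

(** * Prekopa-Leindler on the real line *)

Section one_dim.
Context {R : realType}.
Local Notation mu := (@lebesgue_measure R).

(** All integrals are iterated one-dimensional integrals of functions on [K -> R], so
    Prekopa-Leindler enters on the line, and every change of variables is a translation of one
    coordinate: each matrix entry is its own coordinate minus a sum of coordinates that are
    integrated later. Iterated integrals meet the volume through box covers: the total volume of a
    cover bounds the iterated integral from above, which is the direction that a lower bound for an
    infimum over covers asks for. A supporting line exists if the function is positive on both sides
    of the given margin. This comes from a strictly positive matrix with the given margins,
    [alpha i * beta j / total], around which all coordinates can move a little. There is no such
    matrix when [alpha ord0] is 0; in that case the infimum is at most 0. The slopes come without a
    sign, but the bound on the Laplace transform is finite, and this forces every [s_i + t_j] to be
    positive. *)

Lemma lebesgue_tonelli (g : R * R -> \bar R) : measurable_fun setT g ->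
  (forall p, 0 <= g p)%E ->
  (\int[mu]_x \int[mu]_y g (x, y) = \int[mu]_y \int[mu]_x g (x, y))%E.
Proof. by move=> mg g0; exact: (fubini_tonelli (m1 := mu) (m2 := mu) g mg g0). Qed.

(** Otherwise [A] lies in the interval of length [r] that ends at [sup A]. *)
Lemma measure_gt_diam (A : set R) (r : R) : measurable A -> A !=set0 ->
  (r%:E < mu A)%E -> exists x y, [/\ A x, A y & r <= y - x].
Proof.
move=> mA [z Az] rA; have [r0|r0] := ltP r 0.
  by exists z, z; split=> //; rewrite subrr ltW.
apply: contrapT => nex.
have H x y : A x -> A y -> y - x < r.
  move=> Ax Ay; rewrite ltNge; apply/negP => h; apply: nex.
  by exists x, y.
have ubA : has_sup A.
  by split; [exists z|exists (z + r) => y Ay; have := H _ _ Az Ay; lra].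
have : (mu A <= mu `[(sup A - r)%R, sup A]%classic)%E.
  apply: le_measure; rewrite ?inE//=.
  move=> x Ax /=; rewrite in_itv/=; apply/andP; split; last first.
    exact: sup_upper_bound.
  rewrite lerBlDr; apply: ge_sup; first by exists z.
  by move=> y Ay; have := H _ _ Ax Ay; lra.
rewrite lebesgue_measure_itv/= lte_fin; case: ifPn => h.
  rewrite -EFinB opprB addrC subrK => h'.
  by move: (lt_le_trans rA h'); rewrite ltxx.
by move=> h'; move: (lt_le_trans rA h'); rewrite lte_fin ltNge r0.
Qed.

Lemma measure_ge_diam (A : set R) (x y : R) : is_interval A -> A x -> A y ->
  ((y - x)%:E <= mu A)%E.
Proof.
move=> iA Ax Ay; have [xy|xy] := leP x y; last first.
  apply: (@le_trans _ _ 0%E); last exact: measure_ge0.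
  by rewrite lee_fin subr_le0 ltW.
apply: (@le_trans _ _ (mu `[x, y]%classic)).
  rewrite lebesgue_measure_itv/= lte_fin; case: ifPn => //.
  by rewrite -leNgt lee_fin subr_le0.
apply: le_measure; rewrite ?inE//=.
  exact: is_interval_measurable.
by move=> z /=; rewrite in_itv/= => /andP[xz zy]; apply: (iA x y) => //; rewrite xz.
Qed.

Lemma lee_convex_approx (l : R) (P Q c : \bar R) : 0 < l < 1 ->
  (0 <= P)%E -> (0 <= Q)%E ->
  (forall a b : R, (a%:E < P)%E -> (b%:E < Q)%E ->
    (((1 - l) * a + l * b)%:E <= c)%E) ->
  ((1 - l)%:E * P + l%:E * Q <= c)%E.
Proof.
move=> /andP[l0 l1] P0 Q0 H.
have ltN1 (X : \bar R) : (0 <= X -> (-1)%:E < X)%E.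
  by move=> /(lt_le_trans _); apply; rewrite lte_fin ltrN10.
case: c H => [c||] H; last 2 first.
- by rewrite leey.
- by have := H (-1) (-1) (ltN1 _ P0) (ltN1 _ Q0).
have l1' : 0 < 1 - l by lra.
have Pfin : P \is a fin_num.
  case: P P0 H => [p||] // P0 H.
  (* With this [a] and [b = -1] the left side is [c + 2 - l], which exceeds [c]. *)
  have := H ((c + 2) / (1 - l)) (-1) (ltry _) (ltN1 _ Q0).
  by rewrite mulrCA divff ?gt_eqF// lee_fin; lra.
have Qfin : Q \is a fin_num.
  case: Q Q0 H => [p||] // Q0 H.
  have := H (-1) ((c + 2) / l) (ltN1 _ P0) (ltry _).
  by rewrite [l * _]mulrCA divff ?gt_eqF// lee_fin; lra.
rewrite -(fineK Pfin) -(fineK Qfin) -!EFinM -EFinD lee_fin.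
apply/ler_addgt0Pr => e e0.
have hP : ((fine P - e)%:E < P)%E by rewrite -{2}(fineK Pfin) lte_fin; lra.
have hQ : ((fine Q - e)%:E < Q)%E by rewrite -{2}(fineK Qfin) lte_fin; lra.
have := H _ _ hP hQ; rewrite lee_fin; lra.
Qed.

(** Nearly extremal pairs in [A] and [B] combine to two points of [C] whose distance is the weighted
    mean of theirs; [C] is an interval, so its measure is at least that distance. *)
Lemma brunn_minkowski_1d (l : R) (A B C : set R) : 0 < l < 1 ->
  measurable A -> measurable B -> A !=set0 -> B !=set0 -> is_interval C ->
  (forall x y, A x -> B y -> C ((1 - l) * x + l * y)) ->
  ((1 - l)%:E * mu A + l%:E * mu B <= mu C)%E.
Proof.
move=> l01 mA mB A0 B0 iC ABC; have /andP[l0 l1] := l01.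
apply: lee_convex_approx => // a b.
move=> /(measure_gt_diam mA A0)[x [x' [Ax Ax' xx']]].
move=> /(measure_gt_diam mB B0)[y [y' [By By' yy']]].
apply: le_trans (measure_ge_diam iC (ABC _ _ Ax By) (ABC _ _ Ax' By')).
have l1' : 0 < 1 - l by lra.
rewrite lee_fin.
rewrite (_ : _ + _ - (_ + _) = (1 - l) * (x' - x) + l * (y' - y)); last by ring.
by rewrite lerD// ler_pM2l.
Qed.

Let layer (f : R -> \bar R) (p : R * R) : \bar R :=
  (\1_[set p : R * R | 0 < p.2 /\ (p.2%:E < f p.1)%E] p)%:E.

Let measurable_layer (f : R -> \bar R) : measurable_fun setT f ->
  measurable_fun setT (layer f).
Proof.
move=> mf; apply/measurable_EFinP/measurable_indic.
rewrite (_ : [set _ | _] =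
  [set p : R * R | (0%:E < p.2%:E)%E] `&` [set p : R * R| (p.2%:E < f p.1)%E])//.
apply: measurableI.
- rewrite -[X in measurable X]setTI; apply: measurable_lte => //.
  exact: (measurableT_comp (@EFin_measurable R setT)).
- rewrite -[X in measurable X]setTI; apply: measurable_lte => //.
    exact: (measurableT_comp (@EFin_measurable R setT)).
  exact: measurableT_comp.
Qed.

Let layer_ge0 (f : R -> \bar R) (p : R * R) : (0 <= layer f p)%E.
Proof. by rewrite lee_fin. Qed.

Let measurable_superlevel (f : R -> \bar R) (c : \bar R) : measurable_fun setT f ->
  measurable [set x | (c < f x)%E].
Proof.
by move=> mf; rewrite -[X in measurable X]setTI; exact: measurable_lte.
Qed.

Let layerE (f : R -> \bar R) (t : R) : measurable_fun setT f -> 0 < t ->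
  (\int[mu]_x layer f (x, t) = mu [set x | (t%:E < f x)%E])%E.
Proof.
move=> mf t0; rewrite /layer.
transitivity (\int[mu]_x (\1_[set x | (t%:E < f x)%E] x)%:E)%E.
  apply: eq_integral => x _; rewrite !indicE; congr ((nat_of_bool _)%:R%:E).
  by apply/idP/idP; rewrite !inE/=; [case|split].
rewrite integral_indic//; last exact: measurable_superlevel.
by rewrite setIT.
Qed.

Lemma measurable_measure_superlevel (f : R -> \bar R) : measurable_fun setT f ->
  measurable_fun (`]0%R, +oo[%classic : set R)
    (fun t : R => mu [set x | (t%:E < f x)%E]).
Proof.
move=> mf.
apply: (@eq_measurable_fun _ _ _ _ _ (fun t => \int[mu]_x layer f (x, t))%E).
  by move=> t; rewrite inE/= in_itv/= andbT => t0; rewrite layerE.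
apply: measurable_funTS.
apply: (measurable_fun_fubini_tonelli_G (m1 := mu) (layer f)) => [|p].
  exact: measurable_layer.
exact: layer_ge0.
Qed.

Lemma layer_cake (f : R -> \bar R) : measurable_fun setT f ->
  (forall x, 0 <= f x)%E ->
  (\int[mu]_x f x = \int[mu]_(t in `]0%R, +oo[) mu [set x | (t%:E < f x)%E])%E.
Proof.
move=> mf f0.
transitivity (\int[mu]_x \int[mu]_t layer f (x, t))%E.
  apply: eq_integral => x _; rewrite /layer.
  have fx0 := f0 x.
  transitivity (mu [set t : R| (0 < t)%R /\ (t%:E < f x)%E]).
    case: (f x) fx0 => [r||] // r0.
      rewrite (_ : [set _ | _] = `]0%R, r[%classic); last first.
        by apply/seteqP; split => t/=; rewrite in_itv/= lte_fin => /andP.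
      rewrite lebesgue_measure_itv/= lte_fin; case: ifPn; rewrite ?oppr0 ?adde0//.
      by rewrite -leNgt => r0'; apply/eqP; rewrite eq_le r0 andbT lee_fin.
    rewrite (_ : [set _ | _] = `]0%R, +oo[%classic); last first.
      by apply/seteqP; split => t/=; rewrite in_itv/= ltry andbT; [case|split].
    by rewrite lebesgue_measure_itv/= ltry sube0.
  rewrite -[X in mu X]setIT -integral_indic//.
  rewrite (_ : [set _ | _] = [set t | (0 < t%:E)%E] `&` [set t | (t%:E < f x)%E])//.
  by apply: measurableI; rewrite -[X in measurable X]setTI;
    apply: measurable_lte => //; exact/measurable_EFinP.
rewrite lebesgue_tonelli//; last exact: measurable_layer.
rewrite [RHS]integral_mkcond; apply: eq_integral => t _.
rewrite patchE; case: ifPn => tD.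
  by rewrite layerE//; move: tD; rewrite inE/= in_itv/= andbT.
apply: integral0_eq => x _; rewrite /layer indicE memNset//= => -[t0 _].
by move/negP: tD; apply; rewrite inE/= in_itv/= t0.
Qed.

(** Since [f] and [g] both have supremum 1, their superlevel sets are nonempty at the same levels
    [t < 1], as Brunn-Minkowski requires, and both empty from 1 on. Integrating over the levels
    gives an arithmetic mean. *)
Lemma prekopa_leindler_normalized (l : R) (f g h : R -> \bar R) : 0 < l < 1 ->
  measurable_fun setT f -> measurable_fun setT g -> measurable_fun setT h ->
  (forall x, 0 <= f x <= 1)%E -> (forall x, 0 <= g x <= 1)%E ->
  (forall x, 0 <= h x)%E ->
  (forall t, 0 < t < 1 -> exists x, (t%:E < f x)%E) ->
  (forall t, 0 < t < 1 -> exists x, (t%:E < g x)%E) ->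
  (forall t, 0 < t -> is_interval [set x | (t%:E < h x)%E]) ->
  (forall t x y, 0 < t -> (t%:E < f x)%E -> (t%:E < g y)%E ->
    (t%:E < h ((1 - l) * x + l * y)%R)%E) ->
  ((1 - l)%:E * \int[mu]_x f x + l%:E * \int[mu]_x g x <= \int[mu]_x h x)%E.
Proof.
move=> l01 mf mg mh f01 g01 h0 fs gs ih H; have /andP[l0 l1] := l01.
have f0 x : (0 <= f x)%E by have /andP[] := f01 x.
have g0 x : (0 <= g x)%E by have /andP[] := g01 x.
rewrite !layer_cake//.
have mD : measurable (`]0%R, +oo[%classic : set R) by [].
have l1' : 0 <= 1 - l by lra.
have scale (k : R) (u : R -> \bar R) : 0 <= k -> measurable_fun setT u ->
    (k%:E * \int[mu]_(t in `]0%R, +oo[) mu [set x | t%:E < u x] =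
     \int[mu]_(t in `]0%R, +oo[) (k%:E * mu [set x | t%:E < u x]))%E.
  by move=> k0 mmu; rewrite ge0_integralZl//; exact: measurable_measure_superlevel.
have l0' := ltW l0; rewrite !scale//.
rewrite -ge0_integralD//; last 4 first.
- by move=> t _; rewrite mule_ge0.
- by apply: measurable_funeM; exact: measurable_measure_superlevel.
- by move=> t _; rewrite mule_ge0// lee_fin ltW.
- by apply: measurable_funeM; exact: measurable_measure_superlevel.
apply: ge0_le_integral => //.
- by move=> t _; rewrite adde_ge0// mule_ge0// lee_fin ltW.
- by apply: emeasurable_funD;
    apply: measurable_funeM; exact: measurable_measure_superlevel.
- exact: measurable_measure_superlevel.
move=> t /=; rewrite in_itv/= andbT => t0.
have [t1|t1] := ltP t 1.
  have t01 : 0 < t < 1 by rewrite t0.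
  apply: brunn_minkowski_1d => //; try exact: measurable_superlevel.
  - exact: fs.
  - exact: gs.
  - exact: ih.
  - by move=> x y /= fx gy; exact: H.
have empty (k : R -> \bar R) : (forall x, 0 <= k x <= 1)%E ->
    [set x | (t%:E < k x)%E] = set0.
  move=> k01; apply/seteqP; split => x //=.
  have /andP[_ k1] := k01 x.
  by move=> /lt_le_trans/(_ k1); rewrite lte_fin ltNge t1.
have m0 : mu set0 = 0%E by exact: measure0.
by rewrite (empty _ f01) (empty _ g01) m0 !mule0 adde0.
Qed.

End one_dim.

(** * From normalized to arbitrary functions *)

Section prekopa_leindler.
Context {R : realType}.
Local Notation mu := (@lebesgue_measure R).

Lemma lee_lt_real (x y : \bar R) :
  (forall a : R, (a%:E < x)%E -> (a%:E <= y)%E) -> (x <= y)%E.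
Proof.
move=> H; rewrite leNgt; apply/negP => yx.
case: x H yx => [x||] H //; case: y H => [y||] H //.
- rewrite lte_fin => yx; have := H ((x + y) / 2)%R.
  by rewrite lte_fin lee_fin; lra.
- by move=> _; have := H (x - 1)%R; rewrite lte_fin ltrBlDr ltrDl ltr01 => /(_ isT).
- by move=> _; have := H (y + 1)%R; rewrite ltry lee_fin => /(_ isT); lra.
- by move=> _; have := H 0%R; by rewrite ltry => /(_ isT).
Qed.

Lemma exists_real_between (t : R) (x y : \bar R) :
  (t%:E < x)%E -> (t%:E < y)%E ->
  exists u, [/\ t < u, (u%:E < x)%E & (u%:E < y)%E].
Proof.
move=> tx ty; have : (t%:E < mine x y)%E by rewrite lt_min tx.
have [u [tu]] : exists u, t < u /\ ((t%:E < mine x y)%E -> (u%:E < mine x y)%E).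
  case: (mine x y) => [z||].
  - have [tz|zt] := ltP t z; last first.
      by exists (t + 1); rewrite !lte_fin ltrDl ltr01; split => // ?; lra.
    by exists ((t + z) / 2); rewrite !lte_fin; split => [|_]; lra.
  - by exists (t + 1); rewrite !ltry ltrDl ltr01.
  - by exists (t + 1); rewrite ltrDl ltr01.
by move=> H /H; rewrite lt_min => /andP[]; exists u.
Qed.

Lemma expR_convex (l a b : R) : 0 < l < 1 ->
  expR ((1 - l) * a + l * b) <= (1 - l) * expR a + l * expR b.
Proof.
move=> /andP[l0 l1]; set z := _ + _.
have za : expR z * (1 + (a - z)) <= expR a.
  rewrite [leRHS](_ : _ = expR z * expR (a - z)); last by rewrite -expRD addrC subrK.
  by rewrite ler_pM2l ?expR_gt0// expR_ge1Dx.
have zb : expR z * (1 + (b - z)) <= expR b.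
  rewrite [leRHS](_ : _ = expR z * expR (b - z)); last by rewrite -expRD addrC subrK.
  by rewrite ler_pM2l ?expR_gt0// expR_ge1Dx.
have -> : expR z = (1 - l) * (expR z * (1 + (a - z))) + l * (expR z * (1 + (b - z))).
  by rewrite /z; ring.
by rewrite lerD// ler_pM2l//; lra.
Qed.

(** A bounded truncation has a finite supremum, so it can be rescaled to supremum 1. *)
Lemma integral_truncation (f : R -> \bar R) (a : R) : measurable_fun setT f ->
  (forall x, 0 <= f x)%E -> (a%:E < \int[mu]_x f x)%E ->
  exists N : nat, (a%:E < \int[mu]_x mine (f x) N%:R%:E)%E.
Proof.
move=> mf f0 af; apply: contrapT => nex.
pose g (n : nat) x := mine (f x) n%:R%:E.
have mg n : measurable_fun setT (g n) by exact: measurable_mine.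
have g0 n x : setT x -> (0 <= g n x)%E by move=> _; rewrite /g le_min f0 lee_fin ler0n.
have gnd x : setT x -> {homo g^~ x : n m / (n <= m)%N >-> (n <= m)%E}.
  by move=> _ n m nm; rewrite /g le_min !ge_min lexx/= lee_fin ler_nat nm orbT.
have gf x : (f x <= limn (g^~ x))%E.
  apply: lee_lt_real => b bf.
  have bN : b < (Num.truncn `|b|).+1%:R.
    by rewrite (le_lt_trans (ler_norm b))// truncnS_gt.
  apply: (@le_trans _ _ (g (Num.truncn `|b|).+1 x)).
    by rewrite /g le_min (ltW bf)/= lee_fin ltW.
  have cv := ereal_nondecreasing_cvgn (gnd x I).
  by rewrite (cvg_lim _ cv)//; apply: ereal_sup_ubound; exists (Num.truncn `|b|).+1.
have le_lim : (\int[mu]_x f x <= limn (fun n => \int[mu]_x g n x))%E.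
  rewrite -monotone_convergence//; apply: ge0_le_integral => //.
  apply: (emeasurable_fun_cvg g) => // x _.
  have cv := ereal_nondecreasing_cvgn (gnd x I).
  by rewrite (cvg_lim _ cv).
have lim_le : (limn (fun n => \int[mu]_x g n x) <= a%:E)%E.
  apply: lime_le.
    apply: ereal_nondecreasing_is_cvgn => n m nm.
    by apply: ge0_le_integral => // [|||x _]; [exact: g0|exact: mg|exact: mg|exact: (gnd x I)].
  by apply: nearW => n; rewrite leNgt; apply/negP => h; apply: nex; exists n.
by move: (lt_le_trans af (le_trans le_lim lim_le)); rewrite ltxx.
Qed.

(** Here [expR m] is the supremum of a truncation of [f], and [g] is that truncation divided by
    it. *)
Lemma exists_normalized_truncation (f : R -> \bar R) (a : R) :
  measurable_fun setT f -> (forall x, 0 <= f x)%E ->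
  ((expR a)%:E < \int[mu]_x f x)%E ->
  exists (m : R) (g : R -> \bar R),
    [/\ measurable_fun setT g, forall x, (0 <= g x <= 1)%E,
        forall x, ((expR m)%:E * g x <= f x)%E,
        forall t, 0 < t < 1 -> exists x, (t%:E < g x)%E &
        ((expR (a - m))%:E < \int[mu]_x g x)%E].
Proof.
move=> mf f0 /(integral_truncation mf f0)[N].
set F := fun x => mine (f x) N%:R%:E => aF.
have F0 x : (0 <= F x)%E by rewrite /F le_min f0 lee_fin ler0n.
have mF : measurable_fun setT F by exact: measurable_mine.
pose S := ereal_sup (range F).
have FS x : (F x <= S)%E by apply: ereal_sup_ubound; exists x.
have SN : (S <= N%:R%:E)%E.
  by apply: ge_ereal_sup => _ [x _ <-]; rewrite /F ge_min lexx orbT.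
have S0 : (0 < S)%E.
  rewrite ltNge; apply/negP => S0.
  move: aF; rewrite integral0_eq ?lte_fin; first by rewrite ltNge expR_ge0.
  by move=> x _; apply/eqP; rewrite eq_le F0 andbT (le_trans (FS x)).
have [s s0 Ss] : exists2 s : R, 0 < s & S = s%:E.
  case: (S) S0 SN => [s||]//; rewrite ?lte_fin => s0 _; first by exists s.
exists (ln s), (fun x => (s^-1)%:E * F x)%E.
rewrite lnK ?posrE//.
have is0 : 0 < s^-1 by rewrite invr_gt0.
split.
- exact: measurable_funeM.
- move=> x; rewrite mule_ge0//=; last by rewrite lee_fin ltW.
  by rewrite lee_pdivrMl// mule1 -Ss.
- by move=> x; rewrite muleA -EFinM divff ?gt_eqF// mul1e /F ge_min lexx.
- move=> t /andP[t0 t1].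
  have : ((s * t)%:E < S)%E by rewrite Ss lte_fin gtr_pMr.
  move=> /ereal_sup_gt[_ [x _ <-]] h; exists x.
  by rewrite lte_pdivlMl// -EFinM.
- rewrite ge0_integralZl//; last by rewrite lee_fin ltW.
  by rewrite expRB lnK ?posrE// mulrC EFinM lte_pmul2l.
Qed.

(** After division by the suprema the normalized case bounds the integral of [h] below by an
    arithmetic mean, and convexity of [expR] passes from there to the geometric mean. *)
Lemma prekopa_leindler_1d (l : R) (f g h : R -> \bar R) : 0 < l < 1 ->
  measurable_fun setT f -> measurable_fun setT g -> measurable_fun setT h ->
  (forall x, 0 <= f x)%E -> (forall x, 0 <= g x)%E -> (forall x, 0 <= h x)%E ->
  (forall t, 0 < t -> is_interval [set x | (t%:E < h x)%E]) ->
  (forall x y a b, ((expR a)%:E < f x)%E -> ((expR b)%:E < g y)%E ->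
    ((expR ((1 - l) * a + l * b))%:E <= h ((1 - l) * x + l * y)%R)%E) ->
  forall a b, ((expR a)%:E < \int[mu]_x f x)%E ->
    ((expR b)%:E < \int[mu]_x g x)%E ->
    ((expR ((1 - l) * a + l * b))%:E <= \int[mu]_x h x)%E.
Proof.
move=> l01 mf mg mh f0 g0 h0 ih H a b.
move=> /(exists_normalized_truncation mf f0)[m [F [mF F01 Ff Fs aF]]].
move=> /(exists_normalized_truncation mg g0)[n [G [mG G01 Gg Gs bG]]].
pose k := (1 - l) * m + l * n.
pose K x := ((expR (- k))%:E * h x)%E.
have /andP[l0 l1] := l01.
have : ((1 - l)%:E * \int[mu]_x F x + l%:E * \int[mu]_x G x <= \int[mu]_x K x)%E.
  apply: prekopa_leindler_normalized => //.
  - exact: measurable_funeM.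
  - by move=> x; rewrite mule_ge0// lee_fin expR_ge0.
  - move=> t t0.
    rewrite (_ : [set _ | _] = [set x | ((expR k * t)%:E < h x)%E]).
      by apply: ih; rewrite mulr_gt0 ?expR_gt0.
    by apply/seteqP; split => x /=; rewrite /K expRN lte_pdivlMl ?expR_gt0// -EFinM.
  - move=> t x y t0 tF tG.
    (* The intermediate [u] makes up for the non-strict conclusion of [H]. *)
    have [u [tu uF uG]] := exists_real_between tF tG.
    have u0 : 0 < u by exact: lt_trans tu.
    rewrite (@lt_le_trans _ _ u%:E)// /K expRN lee_pdivlMl ?expR_gt0//.
    rewrite -{1}(lnK u0) -EFinM -expRD.
    rewrite (_ : k + _ = (1 - l) * (m + ln u) + l * (n + ln u)); last first.
      by rewrite /k; ring.
    apply: H.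
    + apply: lt_le_trans (Ff x); rewrite expRD lnK// EFinM.
      by rewrite lte_pmul2l// lte_fin expR_gt0.
    + apply: lt_le_trans (Gg y); rewrite expRD lnK// EFinM.
      by rewrite lte_pmul2l// lte_fin expR_gt0.
have -> : (\int[mu]_x K x = (expR (- k))%:E * \int[mu]_x h x)%E.
  by rewrite -ge0_integralZl// lee_fin expR_ge0.
rewrite expRN lee_pdivlMl ?expR_gt0//; apply: le_trans.
rewrite (_ : _ + _ = k + ((1 - l) * (a - m) + l * (b - n))); last first.
  by rewrite /k; ring.
rewrite expRD EFinM lee_pmul2l// ?lte_fin ?expR_gt0//.
apply: (@le_trans _ _ ((1 - l) * expR (a - m) + l * expR (b - n))%:E).
  by rewrite lee_fin expR_convex.
have l1' : 0 < 1 - l by lra.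
by rewrite EFinD !EFinM leeD// lee_pmul2l// ltW.
Qed.

End prekopa_leindler.

(** * Iterated integrals of log-concave functions *)

Section marginal.
Context {R : realType} {K : eqType}.
Local Notation mu := (@lebesgue_measure R).
Implicit Types (f g : (K -> R) -> \bar R) (x u v : K -> R) (i j k : K).

Definition upd x i (t : R) : K -> R := fun k => if k == i then t else x k.

(** The result keeps the type of [f] and merely ignores coordinate [i], so marginals in several
    coordinates compose freely. *)
Definition marginal i f x : \bar R := (\int[mu]_t f (upd x i t))%E.

(* Measurability on the product space [K -> R], phrased without equipping that
   type with a sigma-algebra. *)
Definition coord_measurable d' (U : measurableType d') (h : (K -> R) -> U) :=
  forall d (T : measurableType d) (phi : T -> K -> R),
    (forall k, measurable_fun setT (fun t => phi t k)) ->
    measurable_fun setT (fun t => h (phi t)).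

Definition nonneg_measurable f := (forall x, 0 <= f x)%E /\ coord_measurable f.

(** The reals [a] and [b] stand in for [ln (f u)] and [ln (f v)]: there are none where [f] vanishes,
    and they are arbitrary where [f] is [+oo]. *)
Definition log_concave f := forall (l : R) u v (a b : R), 0 < l < 1 ->
  ((expR a)%:E < f u)%E -> ((expR b)%:E < f v)%E ->
  ((expR ((1 - l) * a + l * b))%:E <= f (fun k => (1 - l) * u k + l * v k)%R)%E.

Lemma upd_swap x i j s t : i != j -> upd (upd x i s) j t = upd (upd x j t) i s.
Proof.
move=> ij; apply/funext => k; rewrite /upd.
by case: eqVneq => [->|//]; rewrite eq_sym (negbTE ij).
Qed.

Lemma measurable_upd x i k : measurable_fun setT (fun t : R => upd x i t k).
Proof. by rewrite /upd; case: (k == i). Qed.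

Lemma measurable_marginal_section f x i : nonneg_measurable f ->
  measurable_fun setT (fun t : R => f (upd x i t)).
Proof. by move=> [_ mf]; apply: mf => k; exact: measurable_upd. Qed.

Lemma marginal_ge0 i f x : (forall x, 0 <= f x)%E -> (0 <= marginal i f x)%E.
Proof. by move=> f0; apply: integral_ge0 => t _; exact: f0. Qed.

Lemma nonneg_measurable_marginal i f : nonneg_measurable f ->
  nonneg_measurable (marginal i f).
Proof.
move=> [f0 mf]; split=> [x|d T phi mphi]; first exact: marginal_ge0.
pose F (p : T * R) := f (upd (phi p.1) i p.2).
apply: (measurable_fun_fubini_tonelli_F (m2 := mu) F) => [|p]; last exact: f0.
apply: (mf _ _ (fun p : T * R => upd (phi p.1) i p.2)) => k; rewrite /upd.
case: (k == i); first exact: measurable_snd.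
exact: (measurableT_comp (mphi k) measurable_fst).
Qed.

Lemma marginal_swap i j f : nonneg_measurable f ->
  marginal i (marginal j f) = marginal j (marginal i f).
Proof.
have [->//|ij] := eqVneq i j.
move=> [f0 mf]; apply/funext => x; rewrite /marginal.
pose F (p : R * R) := f (upd (upd x i p.1) j p.2).
have F0 p : (0 <= F p)%E by exact: f0.
have mF : measurable_fun setT F.
  apply: (mf _ _ (fun p : R * R => upd (upd x i p.1) j p.2)) => k; rewrite /upd.
  case: (k == j); first exact: measurable_snd.
  by case: (k == i) => //; exact: measurable_fst.
apply: (etrans (lebesgue_tonelli mF F0)).
apply: eq_integral => t _; apply: eq_integral => s _.
by rewrite /F upd_swap.
Qed.

Lemma le_marginal i f g x : nonneg_measurable f -> nonneg_measurable g ->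
  (forall t, (f (upd x i t) <= g (upd x i t))%E) ->
  (marginal i f x <= marginal i g x)%E.
Proof.
move=> mf mg fg; apply: ge0_le_integral => //.
- by move=> t _; case: mf.
- exact: measurable_marginal_section.
- exact: measurable_marginal_section.
Qed.

Lemma marginalZl i f (c : (K -> R) -> \bar R) : nonneg_measurable f ->
  (forall x, 0 <= c x)%E -> (forall x t, c (upd x i t) = c x) ->
  marginal i (fun x => c x * f x)%E = (fun x => c x * marginal i f x)%E.
Proof.
move=> mf c0 ci; apply/funext => x; rewrite /marginal -ge0_integralZl//.
- by apply: eq_integral => t _; rewrite ci.
- exact: measurable_marginal_section.
- by move=> t _; case: mf.
Qed.

Lemma log_concave_marginal i f : nonneg_measurable f -> log_concave f ->
  log_concave (marginal i f).
Proof.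
move=> mf lf l u v a b l01; apply: prekopa_leindler_1d => //;
  try exact: measurable_marginal_section; try by move=> t; case: mf.
(* Superlevel sets on a line are intervals: log-concavity is applied with the weight [r] of [y] in
   [z]. *)
- move=> t t0 x y /= fx fy z /andP[xz zy].
  have [->//|xz'] := eqVneq z x; have [->//|zy'] := eqVneq z y.
  have xltz : x < z by rewrite lt_neqAle eq_sym xz'.
  have zlty : z < y by rewrite lt_neqAle zy'.
  have [s [ts sx sy]] := exists_real_between fx fy.
  have s0 : 0 < s by exact: lt_trans ts.
  pose r := (z - x) / (y - x).
  have yx0 : 0 < y - x by rewrite subr_gt0 (lt_trans xltz).
  have r01 : 0 < r < 1.
    apply/andP; split; first by apply: divr_gt0 => //; rewrite subr_gt0.
    by rewrite /r ltr_pdivrMr// mul1r ltrD2r.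
  rewrite -(lnK s0) in sx sy.
  have := lf r _ _ _ _ r01 sx sy.
  rewrite -mulrDl subrK mul1r lnK//.
  rewrite (_ : (fun k => _) = upd (fun k => (1 - l) * u k + l * v k) i z); last first.
    apply/funext => k; rewrite /upd; case: eqP => _; last by rewrite -mulrDl subrK mul1r.
    by rewrite /r; field; rewrite gt_eqF.
  by apply: lt_le_trans; rewrite lte_fin.
- move=> x y c d fx gy; have := lf _ _ _ _ _ l01 fx gy.
  rewrite (_ : (fun k => _) =
    upd (fun k => (1 - l) * u k + l * v k) i ((1 - l) * x + l * y))//.
  by apply/funext => k; rewrite /upd; case: eqP.
Qed.

(** The head of [s] is integrated first, hence innermost. *)
Definition marginals (s : seq K) f := foldl (fun g i => marginal i g) f s.

Lemma marginals_cat s1 s2 f :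
  marginals (s1 ++ s2) f = marginals s2 (marginals s1 f).
Proof. exact: foldl_cat. Qed.

Lemma nonneg_measurable_marginals s f : nonneg_measurable f ->
  nonneg_measurable (marginals s f).
Proof.
by elim: s f => // i s IH f mf; apply: IH; exact: nonneg_measurable_marginal.
Qed.

Lemma log_concave_marginals s f : nonneg_measurable f -> log_concave f ->
  log_concave (marginals s f).
Proof.
elim: s f => // i s IH f mf lf; apply: IH; first exact: nonneg_measurable_marginal.
exact: log_concave_marginal.
Qed.

Lemma marginals_marginal s i f : nonneg_measurable f ->
  marginals s (marginal i f) = marginal i (marginals s f).
Proof.
elim: s f => // j s IH f mf /=; rewrite marginal_swap// IH//.
exact: nonneg_measurable_marginal.
Qed.

Lemma marginals_catC s1 s2 f : nonneg_measurable f ->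
  marginals (s1 ++ s2) f = marginals (s2 ++ s1) f.
Proof.
elim: s1 s2 f => [|i s1 IH] s2 f mf; first by rewrite cats0.
rewrite [LHS]/= IH; last exact: nonneg_measurable_marginal.
by rewrite !marginals_cat/= marginals_marginal.
Qed.

Lemma le_marginals s f g p : nonneg_measurable f -> nonneg_measurable g ->
  (forall x, (forall k, k \notin s -> x k = p k) -> (f x <= g x)%E) ->
  (marginals s f p <= marginals s g p)%E.
Proof.
elim: s f g => [|i s IH] f g mf mg fg; first exact: fg.
apply: IH => [||x xp]; [exact: nonneg_measurable_marginal..|].
apply: le_marginal => // t; apply: fg => k; rewrite inE negb_or => /andP[ki ks].
by rewrite /upd (negbTE ki) xp.
Qed.

Lemma marginalsZl s f (c : (K -> R) -> \bar R) : nonneg_measurable f ->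
  (forall x, 0 <= c x)%E -> (forall x i t, i \in s -> c (upd x i t) = c x) ->
  marginals s (fun x => c x * f x)%E = (fun x => c x * marginals s f x)%E.
Proof.
elim: s f => // i s IH f mf c0 cs /=; rewrite marginalZl//.
  apply: IH => //; first exact: nonneg_measurable_marginal.
  by move=> x j t js; rewrite cs// inE js orbT.
by move=> x t; rewrite cs// inE eqxx.
Qed.

Lemma nonneg_measurableM f g : nonneg_measurable f -> nonneg_measurable g ->
  nonneg_measurable (fun x => f x * g x)%E.
Proof.
move=> [f0 mf] [g0 mg]; split => [x|d T phi mphi]; first exact: mule_ge0.
by apply: emeasurable_funM; [exact: mf|exact: mg].
Qed.

End marginal.

(** * Log-concave functions and their Laplace transforms *)

Section one_dim_capacity.
Context {R : realType}.
Local Notation mu := (@lebesgue_measure R).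

Definition exp_density (c z : R) : R := if 0 <= z then expR (- (c * z)) else 0.

Lemma exp_density_ge0 c z : 0 <= exp_density c z.
Proof. by rewrite /exp_density; case: ifP => // _; exact: expR_ge0. Qed.

Lemma measurable_exp_density c : measurable_fun setT (exp_density c).
Proof.
apply: measurable_fun_ifT => //=.
  exact: measurable_fun_ler.
apply: measurableT_comp => //.
by apply: measurable_funN; exact: measurable_funM.
Qed.

Let integral_exp_density_itv c a :
  (\int[mu]_t (exp_density c (t - a))%:E =
   \int[mu]_(t in `[a, +oo[) (expR (- (c * (t - a))))%:E)%E.
Proof.
rewrite [RHS]integral_mkcond; apply: eq_integral => t _; rewrite patchE /exp_density.
rewrite subr_ge0; case: ifPn => at_; first by rewrite mem_set//= in_itv/= at_.
by rewrite memNset//= in_itv/= andbT; exact/negP.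
Qed.

Lemma integral_exp_density c a : 0 < c ->
  (\int[mu]_t (exp_density c (t - a))%:E = (c^-1)%:E)%E.
Proof.
move=> c0; rewrite integral_exp_density_itv.
pose f t := expR (- (c * (t - a))).
pose F t := - (c^-1 * f t).
have c_neq0 : c != 0 by rewrite gt_eqF.
have df (t : R) : is_derive t 1 f (- c * f t).
  rewrite /f; apply: is_derive_eq.
  by rewrite /GRing.scale/=; ring.
have dF (t : R) : is_derive t 1 F (f t).
  rewrite /F; apply: is_derive_eq.
  by rewrite /GRing.scale/=; field.
have cf : continuous f.
  by move=> t; apply: differentiable_continuous; apply/derivable1_diffP; exact: ex_derive.
have cF : continuous F.
  by move=> t; apply: differentiable_continuous; apply/derivable1_diffP; exact: ex_derive.
rewrite (@ge0_continuous_FTC2y _ _ F _ 0)//.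
- by rewrite /F /f subrr mulr0 oppr0 expR0 mulr1 EFinN oppeK add0e.
- exact: continuous_subspaceT.
- rewrite (_ : F = fun t => - (c^-1 * expR (c * a)) * expR (- (c * t))); last first.
    apply/funext => t; rewrite mulNr -mulrA -expRD /F /f.
    by congr (- (_ * expR _)); ring.
  rewrite -[X in _ --> X](mulr0 (- (c^-1 * expR (c * a)))).
  apply: cvgM; first exact: cvg_cst.
  apply: (@cvg_comp _ _ _ (fun t => c * t) (fun t => expR (- t)) _ (pinfty_nbhs R));
    last exact: cvgr_expR.
  exact: gt0_cvgMry.
- by apply: cvg_at_right_filter; exact: cF.
- by move=> t _; rewrite derive1E derive_val.
Qed.

(** The integrand is at least 1 on the half line. This divergence later excludes nonpositive
    rates. *)
Lemma integral_exp_density_infty c a : c <= 0 ->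
  (\int[mu]_t (exp_density c (t - a))%:E = +oo)%E.
Proof.
move=> c0; rewrite integral_exp_density_itv.
apply/eqP; rewrite -leye_eq.
apply: (@le_trans _ _ (\int[mu]_(t in `[a, +oo[) (cst 1 t))%E).
  by rewrite integral_cst//= lebesgue_measure_itv/= ltry mul1e.
apply: ge0_le_integral => //.
  apply/measurable_EFinP; apply: measurable_funTS; apply: measurableT_comp => //.
  by apply: measurable_funN; apply: measurable_funM => //; exact: measurable_funB.
move=> t /=; rewrite in_itv/= andbT => at_.
by rewrite lee_fin -expR0 ler_expR -mulNr mulr_ge0 ?oppr_ge0 ?subr_ge0.
Qed.

Definition log_concave1 (g : R -> \bar R) := forall (l x y a b : R), 0 < l < 1 ->
  ((expR a)%:E < g x)%E -> ((expR b)%:E < g y)%E ->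
  ((expR ((1 - l) * a + l * b))%:E <= g ((1 - l) * x + l * y)%R)%E.

Lemma exists_lt_expR (x : \bar R) : (0 < x)%E -> exists r : R, ((expR r)%:E < x)%E.
Proof.
move=> x0; have [u [u0 ux _]] := exists_real_between x0 x0.
by exists (ln u); rewrite lnK.
Qed.

Lemma lee_expR_lt (x : \bar R) (y : R) : 0 <= y ->
  (forall r, ((expR r)%:E < x)%E -> expR r <= y) -> (x <= y%:E)%E.
Proof.
move=> y0 H; apply: lee_lt_real => a ax; rewrite lee_fin.
have [a0|a0] := leP a 0; first exact: le_trans y0.
by rewrite -(lnK a0) H// lnK.
Qed.

(** By the three-chord inequality each chord slope from [p] to the right is at most each one to the
    left; [s] is the supremum of the right slopes. The point [y0] makes their set nonempty and [x0]
    bounds it. *)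
Lemma exists_supporting_slope (g : R -> \bar R) (A p x0 y0 : R) :
  log_concave1 g -> g p = (expR A)%:E -> x0 < p -> p < y0 ->
  (0 < g x0)%E -> (0 < g y0)%E ->
  exists s : R, forall q, (g q <= (expR (A + s * (q - p)))%:E)%E.
Proof.
move=> lg gp x0p py0 gx0 gy0.
have three x y r r' : x < p -> p < y -> ((expR r)%:E < g x)%E ->
    ((expR r')%:E < g y)%E -> (r' - A) / (y - p) <= (A - r) / (p - x).
  move=> xp py gx gy.
  have yx : 0 < y - x by lra.
  (* This is the weight of [y] when [p] is written as a convex combination of [x] and [y]. *)
  have l01 : 0 < (p - x) / (y - x) < 1.
    apply/andP; split; first by apply: divr_gt0 => //; lra.
    by rewrite ltr_pdivrMr//; lra.
  have := lg _ _ _ _ _ l01 gx gy.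
  rewrite (_ : (1 - _) * x + _ = p); last by field; rewrite gt_eqF.
  rewrite gp lee_fin ler_expR => H.
  rewrite ler_pdivrMr ?subr_gt0// mulrAC ler_pdivlMr ?subr_gt0//.
  have : ((1 - (p - x) / (y - x)) * r + (p - x) / (y - x) * r') * (y - x) <= A * (y - x).
    by rewrite ler_pM2r.
  rewrite (_ : (_ + _) * (y - x) = (y - p) * r + (p - x) * r'); last by field; rewrite gt_eqF.
  by lra.
pose S := [set s : R | exists y r', [/\ p < y, ((expR r')%:E < g y)%E &
  s = (r' - A) / (y - p)]].
have [r0 gr0] := exists_lt_expR gx0.
have [r1 gr1] := exists_lt_expR gy0.
have S0 : S !=set0 by exists ((r1 - A) / (y0 - p)); exists y0, r1.
have Sub : has_ubound S.
  by exists ((A - r0) / (p - x0)) => _ [y [r' [py gy ->]]]; exact: three.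
exists (sup S) => q; apply: lee_expR_lt; first exact: expR_ge0.
move=> r gq; rewrite ler_expR.
have [qp|pq|qp] := ltgtP q p.
- have : sup S <= (A - r) / (p - q).
    by apply: ge_sup => // _ [y [r' [py gy ->]]]; exact: three.
  by rewrite ler_pdivlMr ?subr_gt0//; lra.
- have : (r - A) / (q - p) <= sup S by apply: ub_le_sup => //; exists q, r.
  by rewrite ler_pdivrMr ?subr_gt0//; lra.
- by move: gq; rewrite qp gp lte_fin ltr_expR subrr mulr0 addr0 => /ltW.
Qed.

(* Take [t = s + 1 / p] with [s] the slope at [p] of a supporting line of [ln g]:
   this bounds [g q * expR (- t * (q - p))] by
   [g p * expR (1 - q / p)], whose integral over the half line is [e * p * g p]. *)
Lemma log_concave1_capacity (g : R -> \bar R) (p x0 y0 : R) :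
  measurable_fun setT g -> (forall x, 0 <= g x)%E -> log_concave1 g ->
  (forall q, q < 0 -> g q = 0%E) -> (0 < g p)%E -> (g p < +oo)%E ->
  0 < p -> x0 < p -> p < y0 -> (0 < g x0)%E -> (0 < g y0)%E ->
  exists t : R,
    (\int[mu]_q ((expR (- (t * (q - p))))%:E * g q) <= (expR 1 * p)%:E * g p)%E.
Proof.
move=> mg g0 lg gneg gp0 gpy p0 x0p py0 gx0 gy0.
have [A gpA] : exists A, g p = (expR A)%:E.
  case: (g p) gp0 gpy => [z||]//; rewrite lte_fin => z0 _.
  by exists (ln z); rewrite lnK.
have [s gs] := exists_supporting_slope lg gpA x0p py0 gx0 gy0.
exists (s + p^-1).
have -> : ((expR 1 * p)%:E * g p =
    \int[mu]_q ((expR (A + 1))%:E * (exp_density p^-1 (q - 0))%:E))%E.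
  rewrite ge0_integralZl//.
  - rewrite integral_exp_density ?invr_gt0// invrK gpA -!EFinM expRD; congr EFin; ring.
  - by apply/measurable_EFinP; apply: measurableT_comp => //;
      [exact: measurable_exp_density|exact: measurable_funB].
  - by move=> q _; rewrite lee_fin exp_density_ge0.
apply: ge0_le_integral => //.
- by move=> q _; rewrite mule_ge0// lee_fin expR_ge0.
- apply: emeasurable_funM => //; apply/measurable_EFinP.
  apply: measurableT_comp => //; apply: measurable_funN; apply: measurable_funM => //.
  exact: measurable_funB.
- apply: measurable_funeM; apply/measurable_EFinP; apply: measurableT_comp => //;
    [exact: measurable_exp_density|exact: measurable_funB].
move=> q _; rewrite /exp_density subr0; case: ifPn => q0; last first.
  by rewrite gneg ?mule0// ltNge.
apply: (@le_trans _ _ ((expR (- ((s + p^-1) * (q - p))))%:E * (expR (A + s * (q - p)))%:E))%E.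
  by rewrite lee_wpmul2l// lee_fin expR_ge0.
rewrite -!EFinM -!expRD lee_fin ler_expR le_eqVlt; apply/orP; left; apply/eqP.
by field; rewrite gt_eqF.
Qed.

End one_dim_capacity.

(** * The capacity estimate in several coordinates *)

Section capacity.
Context {R : realType} {K : eqType}.
Local Notation mu := (@lebesgue_measure R).
Implicit Types (f : (K -> R) -> \bar R) (p x u v : K -> R) (i k : K) (s : seq K).

(** If the integral were 0, [g] would vanish almost everywhere, but the interval around [c] has
    measure [2 * e]. *)
Lemma integral_gt0_near (g : R -> \bar R) (c e : R) : measurable_fun setT g ->
  (forall t, 0 <= g t)%E -> 0 < e -> (forall t, `|t - c| < e -> (0 < g t)%E) ->
  (0 < \int[mu]_t g t)%E.
Proof.
move=> mg g0 e0 ge; rewrite lt_neqAle integral_ge0// andbT eq_sym.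
apply/negP => /eqP ig.
pose D : set R := `]c - e, c + e[%classic.
have mD : measurable D by exact: measurable_itv.
have mgD : measurable_fun D g by exact: measurable_funTS.
have iD : (\int[mu]_(t in D) `|g t| = 0)%E.
  apply/eqP; rewrite eq_le integral_ge0 ?andbT//.
  under eq_integral do rewrite gee0_abs//.
  by rewrite -ig; apply: ge0_subset_integral.
have [N [mN N0 DN]] := (ae_eq_integral_abs mu mD mgD).1 iD.
have DN' : D `<=` N.
  move=> t Dt; apply: DN => /= /(_ Dt) gt.
  have := ge t; rewrite gt ltxx => H; apply/notF/H.
  by move: Dt; rewrite /D/= in_itv/= ltr_norml; lra.
have : (mu D <= mu N)%E by apply: le_measure; rewrite ?inE.
rewrite N0 lebesgue_measure_itv/= lte_fin ifT; last by lra.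
by rewrite -EFinB lee_fin; lra.
Qed.

(** A point of the cube of radius [e] about [p] stays in it when coordinate [i] is moved within [e]
    of [p i]. *)
Lemma marginal_gt0 i f p (e : R) : nonneg_measurable f -> 0 < e ->
  (forall x, (forall k, `|x k - p k| < e) -> (0 < f x)%E) ->
  forall x, (forall k, `|x k - p k| < e) -> (0 < marginal i f x)%E.
Proof.
move=> mf e0 fpos x xe; apply: (integral_gt0_near (c := p i) (e := e)) => //.
- exact: measurable_marginal_section.
- by move=> q; case: mf.
- by move=> q qe; apply: fpos => k; rewrite /upd; case: eqP => [->|].
Qed.

Lemma marginals_gt0 s f p (e : R) : nonneg_measurable f -> 0 < e ->
  (forall x, (forall k, `|x k - p k| < e) -> (0 < f x)%E) ->
  forall x, (forall k, `|x k - p k| < e) -> (0 < marginals s f x)%E.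
Proof.
elim: s f => // i s IH f mf e0 fpos; apply: IH => //.
  exact: nonneg_measurable_marginal.
exact: marginal_gt0.
Qed.

Lemma upd_id x i : upd x i (x i) = x.
Proof. by apply/funext => k; rewrite /upd; case: eqP => // ->. Qed.

Lemma upd_same x i t : upd x i t i = t.
Proof. by rewrite /upd eqxx. Qed.

Lemma upd_other x i k t : k != i -> upd x i t k = x k.
Proof. by rewrite /upd => /negbTE ->. Qed.

Lemma log_concave_expM (h : (K -> R) -> R) f :
  (forall l u v, h (fun k => (1 - l) * u k + l * v k) = (1 - l) * h u + l * h v) ->
  log_concave f -> log_concave (fun x => (expR (h x))%:E * f x)%E.
Proof.
move=> hl lf l u v a b l01.
rewrite -!lte_pdivrMl ?expR_gt0// -!expRN -!EFinM -!expRD => fu fv.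
have := lf _ _ _ _ _ l01 fu fv.
rewrite hl -lee_pdivrMl ?expR_gt0// -expRN -EFinM -expRD.
by congr (_ <= _)%E; congr (expR _)%:E; ring.
Qed.

Lemma log_concave_section f x i : log_concave f ->
  log_concave1 (fun t => f (upd x i t)).
Proof.
move=> lf l y z a b l01 fy fz; have := lf _ _ _ _ _ l01 fy fz.
congr (_ <= f _)%E; apply/funext => k; rewrite /upd; case: eqP => // _.
by rewrite -mulrDl subrK mul1r.
Qed.

Lemma nonneg_measurable_expR (h : (K -> R) -> R) : coord_measurable h ->
  nonneg_measurable (fun x => (expR (h x))%:E).
Proof.
move=> mh; split => [x|d T phi mphi]; first by rewrite lee_fin expR_ge0.
by apply/measurable_EFinP; apply: measurableT_comp => //; exact: mh.
Qed.

(** Induction on the coordinates: [t0] comes from the line through [p] in direction [i]. The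
    marginal of the function tilted by [t0] satisfies all hypotheses again, and its value at [p] is
    at most [expR 1 * p i] times [f p]. *)
Lemma log_concave_capacity s f p (e : R) : uniq s ->
  nonneg_measurable f -> log_concave f ->
  (forall x i, i \in s -> x i < 0 -> f x = 0%E) ->
  (forall i, i \in s -> 0 < p i) -> (f p < +oo)%E ->
  0 < e -> (forall x, (forall k, `|x k - p k| < e) -> (0 < f x)%E) ->
  exists t : K -> R,
    (marginals s (fun x => (expR (- \sum_(i <- s) t i * (x i - p i)))%:E * f x) p
      <= (expR 1 ^+ size s * \prod_(i <- s) p i)%:E * f p)%E.
Proof.
elim: s f => [|i s IH] f.
  move=> _ _ _ _ _ _ _ _; exists (fun=> 0) => /=.
  by rewrite !big_nil oppr0 expR0 mulr1.
move=> /= /andP[ins us] mf lf fneg p0 fpy e0 fpos.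
have [f0 _] := mf.
have fp0 : (0 < f p)%E by apply: fpos => k; rewrite subrr normr0.
have upd_near x t : (forall k, `|x k - p k| < e) -> `|t - p i| < e ->
    (0 < f (upd x i t))%E.
  by move=> xe te; apply: fpos => k; rewrite /upd; case: eqP => [->|].
have p_near k : `|p k - p k| < e by rewrite subrr normr0.
have [t0 ht0] : exists t0 : R,
    (\int[mu]_q ((expR (- (t0 * (q - p i))))%:E * f (upd p i q)) <=
      (expR 1 * p i)%:E * f p)%E.
  have fE : f p = f (upd p i (p i)) by rewrite upd_id.
  rewrite fE.
  apply: (@log_concave1_capacity _ (fun q => f (upd p i q)) (p i) (p i - e / 2) (p i + e / 2)).
  - exact: measurable_marginal_section.
  - by move=> q; exact: f0.
  - exact: log_concave_section.
  - by move=> q q0; apply: (fneg _ i); rewrite ?mem_head// upd_same.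
  - by rewrite upd_id.
  - by rewrite upd_id.
  - by rewrite p0// mem_head.
  - by lra.
  - by lra.
  - by apply: upd_near => //; rewrite ltr_norml; lra.
  - by apply: upd_near => //; rewrite ltr_norml; lra.
pose h0 x := - (t0 * (x i - p i)).
pose f1 x := ((expR (h0 x))%:E * f x)%E.
have mf1 : nonneg_measurable f1.
  apply: nonneg_measurableM => //; apply: nonneg_measurable_expR => d T phi mphi.
  apply: measurable_funN; apply: measurable_funM => //.
  by apply: measurable_funB => //; exact: mphi.
have lf1 : log_concave f1.
  by apply: log_concave_expM => // l u v; rewrite /h0; ring.
have f1p : (marginal i f1 p <= (expR 1 * p i)%:E * f p)%E.
  apply: le_trans ht0; rewrite le_eqVlt; apply/orP; left; apply/eqP.
  by apply: eq_integral => q _; rewrite /f1 /h0 upd_same.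
have fneg1 x j : j \in s -> x j < 0 -> marginal i f1 x = 0%E.
  move=> js xj; apply: integral0_eq => q _.
  rewrite /f1 (fneg _ j) ?mule0// ?inE ?js ?orbT//.
  by rewrite upd_other//; apply: contraNneq ins => <-.
have p1 j : j \in s -> 0 < p j by move=> js; rewrite p0// inE js orbT.
have f1y : (marginal i f1 p < +oo)%E.
  apply: (le_lt_trans f1p).
  by case: (f p) fp0 fpy => // r _ _; rewrite -EFinM ltry.
have f1pos : forall x, (forall k, `|x k - p k| < e) -> (0 < marginal i f1 x)%E.
  apply: marginal_gt0 => // x xe.
  by rewrite /f1 mule_gt0 ?lte_fin ?expR_gt0// fpos.
have [t ht] := IH _ us (nonneg_measurable_marginal i mf1)
  (log_concave_marginal mf1 lf1) fneg1 p1 f1y e0 f1pos.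
exists (fun k => if k == i then t0 else t k).
(* The tilts in the remaining coordinates do not involve coordinate [i], so they come out of its
   integral. *)
pose c x := (expR (- \sum_(j <- s) t j * (x j - p j)))%:E : \bar R.
rewrite (_ : (fun x => _) = (fun x => c x * f1 x)%E); last first.
  apply/funext => x; rewrite big_cons eqxx /f1 muleA -EFinM -expRD.
  congr ((expR _)%:E * _)%E; rewrite /h0 opprD addrC; congr (- _ + _).
  apply: eq_big_seq => j js; case: eqP => // ji.
  by move: ins; rewrite -ji js.
rewrite marginalZl//.
- apply: (le_trans ht).
  rewrite exprSr big_cons.
  rewrite (_ : (_ * _ * _)%:E =
    (expR 1 ^+ size s * \prod_(j <- s) p j)%:E * (expR 1 * p i)%:E)%E; last first.
    by rewrite -EFinM; congr EFin; ring.
  rewrite -muleA lee_wpmul2l// lee_fin mulr_ge0 ?exprn_ge0 ?expR_ge0//.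
  by rewrite big_seq prodr_ge0// => j js; rewrite ltW// p0// inE js orbT.
- by move=> x; rewrite lee_fin expR_ge0.
- move=> x q; rewrite /c; congr (expR (- _))%:E.
  apply: eq_big_seq => j js; rewrite upd_other//.
  by apply: contraNneq ins => <-.
Qed.

End capacity.

(** * Iterated integrals of products and of boxes *)

Section product_marginals.
Context {R : realType} {K : eqType}.
Local Notation mu := (@lebesgue_measure R).
Implicit Types (f : (K -> R) -> \bar R) (p x u v : K -> R) (i k : K) (s : seq K).

Lemma nonneg_measurable_cst (r : \bar R) : (0 <= r)%E ->
  nonneg_measurable (fun _ : K -> R => r).
Proof. by move=> r0; split => // d T phi mphi; exact: measurable_cst. Qed.

Lemma nonneg_measurable_prod (I : eqType) (r : seq I) (phi : I -> (K -> R) -> \bar R) :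
  (forall j : I, j \in r -> nonneg_measurable (phi j)) ->
  nonneg_measurable (fun x => \big[mule/1%E]_(j <- r) phi j x).
Proof.
elim: r => [|j r IH] mphi.
  rewrite (_ : (fun _ => _) = (fun=> 1%E)); first exact: nonneg_measurable_cst.
  by apply/funext => x; rewrite big_nil.
rewrite (_ : (fun _ => _) = (fun x => phi j x * \big[mule/1%E]_(j <- r) phi j x)%E).
  apply: nonneg_measurableM; first by apply: mphi; rewrite mem_head.
  by apply: IH => j' jr; apply: mphi; rewrite inE jr orbT.
by apply/funext => x; rewrite big_cons.
Qed.

(** A triangular change of variables: when the coordinate [i] of least rank is integrated, the
    remaining factors are constant in it, and the integral of [phi i] is [I i] whatever the later
    coordinates are. *)
Lemma marginals_prod (rk : K -> nat) s (phi : K -> (K -> R) -> \bar R)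
    (I : K -> \bar R) : uniq s -> sorted (relpre rk leq) s ->
  (forall i, i \in s -> nonneg_measurable (phi i)) ->
  (forall i j x t, i \in s -> j \in s -> i != j -> (rk i <= rk j)%N ->
    phi j (upd x i t) = phi j x) ->
  (forall i x, i \in s -> marginal i (phi i) x = I i) ->
  forall x, marginals s (fun x => \big[mule/1%E]_(i <- s) phi i x) x =
    (\big[mule/1%E]_(i <- s) I i)%E.
Proof.
elim: s => [|i s IH]; first by move=> *; rewrite /= !big_nil.
move=> /= /andP[ins us] ss mphi dep Iphi x.
have sub j : j \in s -> j \in i :: s by rewrite inE => ->; rewrite orbT.
have I0 : (0 <= I i)%E.
  rewrite -(Iphi i x) ?mem_head//; apply: marginal_ge0 => y.
  by have [] := mphi i (mem_head _ _).
pose G x := (\big[mule/1]_(j <- s) phi j x)%E.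
have mG : nonneg_measurable G.
  by apply: nonneg_measurable_prod => j js; apply: mphi; exact: sub.
rewrite (_ : (fun x => _) = (fun x => G x * phi i x)%E); last first.
  by apply/funext => y; rewrite big_cons muleC.
have rki j : j \in s -> (rk i <= rk j)%N.
  have tr : transitive (relpre rk leq) by move=> ? ? ?; exact: leq_trans.
  by move=> js; have /allP/(_ _ js) := order_path_min tr ss.
rewrite marginalZl//; first last.
- move=> y t; rewrite /G; apply: eq_big_seq => j js; apply: dep.
  + exact: mem_head.
  + exact: sub.
  + by apply: contraNneq ins => ->.
  + exact: rki.
- by case: mG.
- by apply: mphi; exact: mem_head.
rewrite (_ : (fun x => _) = (fun x => I i * G x)%E); last first.
  by apply/funext => y; rewrite Iphi ?mem_head// muleC.
rewrite marginalsZl// big_cons IH//.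
- exact: path_sorted ss.
- by move=> j js; apply: mphi; exact: sub.
- by move=> j k y t js ks; apply: dep; exact: sub.
- by move=> j y js; apply: Iphi; exact: sub.
Qed.

Lemma marginals_nneseries s (u : nat -> (K -> R) -> \bar R) :
  (forall n, nonneg_measurable (u n)) ->
  marginals s (fun x => \sum_(n <oo) u n x)%E =
  (fun x => \sum_(n <oo) marginals s (u n) x)%E.
Proof.
elim: s u => // i s IH u mu_ /=.
rewrite (_ : marginal i _ = fun x => (\sum_(n <oo) marginal i (u n) x)%E).
  by apply: IH => n; exact: nonneg_measurable_marginal.
apply/funext => x; apply: integral_nneseries => // n.
  exact: measurable_marginal_section.
by move=> t _; case: (mu_ n).
Qed.

Definition box_indic s (a b : K -> R) x : \bar R :=
  \big[mule/1%E]_(i <- s) (\1_(`[a i, b i]%classic) (x i))%:E.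

Let nonneg_measurable_itv (a b : R) i :
  nonneg_measurable (fun x => (\1_(`[a, b]%classic) (x i))%:E).
Proof.
split => [x|d T phi mphi]; first by rewrite lee_fin.
apply/measurable_EFinP.
have mI : measurable_fun setT (\1_(`[a, b]%classic) : R -> R).
  by apply: measurable_indic; exact: measurable_itv.
exact: (measurableT_comp mI (mphi i)).
Qed.

Lemma nonneg_measurable_box_indic s a b : nonneg_measurable (box_indic s a b).
Proof. by apply: nonneg_measurable_prod => i _; exact: nonneg_measurable_itv. Qed.

Lemma marginals_box_indic s a b p : uniq s -> (forall i, i \in s -> a i <= b i) ->
  marginals s (box_indic s a b) p = (\prod_(i <- s) (b i - a i))%:E.
Proof.
move=> us ab.
(* Each factor depends on its own coordinate alone, so a constant rank suffices. *)
rewrite (marginals_prod (rk := fun=> 0%N) (I := fun i => (b i - a i)%:E))//.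
- by rewrite (big_morph EFin (@EFinM R) erefl).
- by rewrite sorted_pairwise => [|? ? ?]//; elim: (s) => //= i r ->; rewrite andbT; apply/allP.
- by move=> i j x t _ _ ij _; rewrite upd_other// eq_sym.
- move=> i x is_; rewrite /marginal; under eq_integral do rewrite upd_same.
  rewrite integral_indic//= setIT lebesgue_measure_itv/= lte_fin.
  case: ifPn => [_|]; first by rewrite -EFinB.
  by rewrite -leNgt => ba; congr EFin; apply/esym/eqP; rewrite subr_eq0 eq_le ba ab.
Qed.

(** On the slice through [p] the function [f] is dominated by the sum of the indicators of the
    boxes, and their iterated integrals are the volumes of the boxes. *)
Lemma marginals_le_cover s f p (N : set nat) (a b : nat -> K -> R) : uniq s ->
  nonneg_measurable f ->
  (forall n i, i \in s -> a n i <= b n i) ->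
  (forall x, (f x <= 1)%E) ->
  (forall x, (forall k, k \notin s -> x k = p k) -> (0 < f x)%E ->
    exists2 n, N n & forall i, i \in s -> a n i <= x i <= b n i) ->
  (marginals s f p <= \esum_(n in N) (\prod_(i <- s) (b n i - a n i))%:E)%E.
Proof.
move=> us mf ab f1 cover.
(* The factor [\1_N n] turns the sum over [N] into a series over [nat]. *)
pose u n x := ((\1_N n)%:E * box_indic s (a n) (b n) x)%E.
have mu_ n : nonneg_measurable (u n).
  apply: nonneg_measurableM; last exact: nonneg_measurable_box_indic.
  by apply: nonneg_measurable_cst; rewrite lee_fin.
apply: (@le_trans _ _ (marginals s (fun x => \sum_(n <oo) u n x)%E p)).
  apply: le_marginals => //.
    split => [x|d T phi mphi].
      by apply: nneseries_ge0 => n _ _; case: (mu_ n).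
    apply: (ge0_emeasurable_sum (P := xpredT)) => [n x _ _|n _].
      by case: (mu_ n).
    by have [_] := mu_ n; exact.
  move=> x xp; have [fx0|fx0] := leP (f x) 0%E.
    by apply: (le_trans fx0); apply: nneseries_ge0 => n _ _; case: (mu_ n).
  have [n Nn xn] := cover x xp fx0.
  apply: (le_trans (f1 x)).
  have <- : u n x = 1%E.
    rewrite /u indicE mem_set// mul1e /box_indic big1_seq// => i /andP[_ is_].
    by rewrite indicE mem_set//= in_itv/= xn.
  apply: le_trans (nneseries_lim_ge n.+1 _) => [|j _ _]; last by case: (mu_ j).
  rewrite big_mkord big_ord_recr/= leeDr// sume_ge0// => j _.
  by case: (mu_ j).
rewrite marginals_nneseries//.
rewrite esum_mkcond -nneseries_esumT//; last first.
  move=> n; case: ifPn => // _; rewrite lee_fin big_seq prodr_ge0// => i is_.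
  by rewrite subr_ge0 ab.
apply: lee_nneseries => n _.
  by have [] := nonneg_measurable_marginals s (mu_ n).
rewrite /u marginalsZl//; last first.
  exact: nonneg_measurable_box_indic.
rewrite marginals_box_indic//; last exact: ab.
rewrite indicE; case: (n \in N); first by rewrite mul1e.
by rewrite mul0e.
Qed.

End product_marginals.

(** * A chart of the transportation polytope *)

Section gram.
Context {R : realFieldType}.

(** Pairs are indexed lexicographically, so the tensor product of lower triangular matrices is lower
    triangular. *)
Lemma det_tens_trig m n (A : 'M[R]_m) (B : 'M[R]_n) :
  is_trig_mx A -> is_trig_mx B -> \det (A *t B) = \det A ^+ n * \det B ^+ m.
Proof.
move=> tA tB; rewrite [LHS]det_trig; last first.
  apply/is_trig_mxP => r r'.
  case: (mxtens_indexP r) => i j; case: (mxtens_indexP r') => i' j'.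
  rewrite tensmxE => lt_rr'.
  have [ii'|i'i|ii'] := ltngtP i i'.
  - by rewrite (is_trig_mxP tA)// mul0r.
  - exfalso; move: lt_rr'; rewrite /=; apply/negP; rewrite -leqNgt.
    apply: (@leq_trans (i' * n + n)); first by rewrite leq_add2l ltnW.
    by rewrite addnC -mulSn (leq_trans (leq_mul i'i (leqnn n)))// leq_addr.
  - have jj' : (j < j')%N by move: lt_rr'; rewrite /= ii' ltn_add2l.
    by rewrite (is_trig_mxP tB)// mulr0.
rewrite (reindex (@mxtens_index m n)); last first.
  by exists (@mxtens_unindex m n) => k _; [exact: mxtens_indexK|exact: mxtens_unindexK].
rewrite (eq_bigr (fun k => A k.1 k.1 * B k.2 k.2)); last by case=> i j _; rewrite tensmxE.
rewrite -(pair_bigA _ (fun i j => A i i * B j j))/=.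
under eq_bigr do rewrite big_split/= prodr_const card_ord.
by rewrite big_split/= prodrXl prodr_const card_ord !det_trig.
Qed.

(** The identity plus the all-ones matrix, which is the Gram matrix of the vectors [e_a - e_0]. *)
Definition gram k : 'M[R]_k := \matrix_(i, j) ((i == j)%:R + 1).

Let gramP k : 'M[R]_k := \matrix_(i, j) ((i == j) || (j == 0 :> nat))%:R.

(** Upper triangular; the diagonal carries the eigenvalue [k.+1] of the all-ones vector, then
    ones. *)
Let gramU k : 'M[R]_k := \matrix_(i, j)
  (if j == 0 :> nat then (i == 0 :> nat)%:R * k.+1%:R
   else (i == j)%:R + (i == 0 :> nat)%:R).

(* The first column of [gramP] is the all-ones eigenvector of [gram]. *)
Let gram_triangularize k : gram k *m gramP k = gramP k *m gramU k.
Proof.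
apply/matrixP => i j; rewrite !mxE.
case: k i j => [[]//|k] i j.
under eq_bigr do rewrite !mxE mulrDl mul1r.
under [in RHS]eq_bigr do rewrite !mxE.
rewrite big_split/= (bigD1 i)//= eqxx mul1r big1 ?addr0; last first.
  by move=> l li; rewrite eq_sym (negbTE li) mul0r.
have [j0|j0] := eqVneq (j : nat) 0%N.
  under eq_bigr do rewrite orbT.
  under [in RHS]eq_bigr do rewrite mulrA.
  rewrite orbT -mulr_suml [X in _ = X * _](bigD1 ord0)//= orbT mulr1.
  rewrite [X in _ = (_ + X) * _]big1 ?addr0; last first.
    by move=> l l0; rewrite -(val_eqE l) in l0; rewrite (negbTE l0) mulr0.
  by rewrite sumr_const card_ord mul1r -(natrD _ 1).
rewrite orbF; under eq_bigr do rewrite orbF.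
under [in RHS]eq_bigr do rewrite mulrDr.
rewrite big_split/= (bigD1 j)//= eqxx big1 ?addr0; last first.
  by move=> l lj; rewrite (negbTE lj).
rewrite [in RHS](bigD1 j)//= eqxx mulr1 [in RHS]big1 ?addr0; last first.
  by move=> l lj; rewrite (negbTE lj) mulr0.
rewrite [in RHS](bigD1 ord0)//= orbT mulr1 [in RHS]big1 ?addr0; last first.
  by move=> l l0; rewrite -(val_eqE l) in l0; rewrite (negbTE l0) mulr0.
by rewrite (negbTE j0) orbF.
Qed.

(** Tensoring the two triangularizations leaves only triangular factors, whose determinants are read
    off the diagonals. *)
Lemma det_gram_tens m n :
  \det (gram m *t gram n) = m.+1%:R ^+ n * n.+1%:R ^+ m.
Proof.
have trigP k : is_trig_mx (gramP k).
  apply/is_trig_mxP => i j ij; rewrite mxE -val_eqE/=.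
  by rewrite (ltn_eqF ij) (gtn_eqF (leq_ltn_trans _ ij)).
have trigU k : is_trig_mx (gramU k)^T.
  apply/is_trig_mxP => i j ij; rewrite !mxE -!val_eqE/=.
  by rewrite (gtn_eqF ij) (gtn_eqF (leq_ltn_trans _ ij))// mul0r addr0 if_same.
have detP k : \det (gramP k) = 1.
  by rewrite det_trig// big1// => i _; rewrite mxE eqxx.
have detU k : \det (gramU k)^T = k.+1%:R.
  rewrite det_trig//; case: k => [|k]; first by rewrite big_ord0.
  rewrite big_ord_recl !mxE/= mul1r big1 ?mulr1// => i _.
  by rewrite !mxE/= eqxx addr0.
have : \det (gram m *t gram n) * \det (gramP m *t gramP n) =
       \det (gramP m *t gramP n) * \det (gramU m *t gramU n).
  by rewrite -!det_mulmx !tensmx_mul !gram_triangularize.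
rewrite (det_tens_trig (trigP m) (trigP n)) !detP !expr1n !mulr1 mul1r => ->.
by rewrite -det_tr trmx_tens det_tens_trig// !detU.
Qed.

End gram.

(** * Parametrization by the entries off the first row and column *)

Section chart.
Context {R : realType} {m n : nat}.

Definition interior_entry (r : 'I_(m * n)) : 'I_m.+1 * 'I_n.+1 :=
  (lift ord0 (mxtens_unindex r).1, lift ord0 (mxtens_unindex r).2).

Lemma interior_entry_inj : injective interior_entry.
Proof.
move=> r s /pair_equal_spec[/lift_inj h1 /lift_inj h2].
apply: (can_inj (@mxtens_unindexK m n)).
by rewrite [LHS]surjective_pairing [RHS]surjective_pairing h1 h2.
Qed.

Lemma interior_entryP (k : 'I_m.+1 * 'I_n.+1) :
  reflect (exists r, k = interior_entry r) ((k.1 != ord0) && (k.2 != ord0)).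
Proof.
apply: (iffP andP) => [|[r ->]]; last by [].
case: k => i j /= [i0 j0].
case: (unliftP ord0 i) i0 => [a ->|->]; last by rewrite eqxx.
case: (unliftP ord0 j) j0 => [b ->|->]; last by rewrite eqxx.
by exists (mxtens_index (a, b)); rewrite /interior_entry mxtens_indexK.
Qed.

Lemma sum_mxtens (F : 'I_m -> 'I_n -> R) :
  \sum_(r < m * n) F (mxtens_unindex r).1 (mxtens_unindex r).2 =
  \sum_i \sum_j F i j.
Proof.
rewrite pair_bigA (reindex (@mxtens_unindex m n))//=.
by exists (@mxtens_index m n) => k _; [exact: mxtens_unindexK|exact: mxtens_indexK].
Qed.

Definition edge_vector k (a : 'I_k) (i : 'I_k.+1) : R :=
  (i == lift ord0 a)%:R - (i == ord0)%:R.

Lemma sum_edge_vector k (f : 'I_k -> R) i :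
  \sum_a f a * edge_vector a i =
  if unlift ord0 i is Some b then f b else - \sum_a f a.
Proof.
rewrite /edge_vector; case: unliftP => [b ->|->].
  rewrite (bigD1 b)//= eqxx subr0 mulr1 big1 ?addr0// => a ab.
  by rewrite (inj_eq lift_inj) eq_sym (negbTE ab) subr0 mulr0.
rewrite -sumrN; apply: eq_bigr => a _.
by rewrite eqxx (negbTE (neq_lift _ _)) sub0r mulrN1.
Qed.

Definition chart_basis : 'M[R]_(m * n, m.+1 * n.+1) :=
  \matrix_r mxvec (\matrix_(i, j) (edge_vector (mxtens_unindex r).1 i *
                                   edge_vector (mxtens_unindex r).2 j)).

Lemma edge_vector_gram k (a b : 'I_k) :
  \sum_i edge_vector a i * edge_vector b i = (a == b)%:R + 1.
Proof.
under eq_bigr do rewrite mulrC.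
rewrite big_ord_recl {1 2}/edge_vector eqxx !(negbTE (neq_lift _ _)).
rewrite sub0r mulrN1 opprK addrC; congr (_ + _).
under eq_bigr do rewrite {1}/edge_vector (inj_eq lift_inj) /= subr0.
rewrite (bigD1 b)//= eqxx mul1r big1 ?addr0 => [|c cb].
  by rewrite /edge_vector (inj_eq lift_inj) subr0 eq_sym.
by rewrite (negbTE cb) mul0r.
Qed.

Lemma chart_basis_gram : chart_basis *m chart_basis^T = gram m *t gram n.
Proof.
apply/matrixP => r s; rewrite !mxE.
under eq_bigr do rewrite !mxE.
rewrite (reindex _ (curry_mxvec_bij _ _))/=.
rewrite (eq_bigr (fun p : 'I_m.+1 * 'I_n.+1 =>
  (edge_vector (mxtens_unindex r).1 p.1 * edge_vector (mxtens_unindex s).1 p.1) *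
  (edge_vector (mxtens_unindex r).2 p.2 * edge_vector (mxtens_unindex s).2 p.2))).
  rewrite -(pair_bigA _ (fun i j =>
    (edge_vector (mxtens_unindex r).1 i * edge_vector (mxtens_unindex s).1 i) *
    (edge_vector (mxtens_unindex r).2 j * edge_vector (mxtens_unindex s).2 j)))/=.
  by rewrite -big_distrlr/= !edge_vector_gram.
by case=> i j _; rewrite !mxvecE !mxE/= mulrACA.
Qed.

Lemma det_chart_basis :
  \det (chart_basis *m chart_basis^T) = m.+1%:R ^+ n * n.+1%:R ^+ m.
Proof. by rewrite chart_basis_gram det_gram_tens. Qed.

Lemma row_free_chart_basis : row_free chart_basis.
Proof.
have : chart_basis *m chart_basis^T \in unitmx.
  by rewrite unitmxE det_chart_basis unitfE mulf_neq0 ?expf_neq0 ?pnatr_eq0.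
rewrite -row_free_unit /row_free => /eqP h; rewrite eqn_leq rank_leq_row/=.
by rewrite -{1}h mxrankM_maxl.
Qed.

(** The matrix with these row sums (except for row 0) and column sums that vanishes off row 0 and
    column 0; its corner entry compensates for the rest of column 0. *)
Definition chart_origin (alpha : 'I_m.+1 -> R) (beta : 'I_n.+1 -> R) :
    'rV[R]_(m.+1 * n.+1) :=
  mxvec (\matrix_(i, j)
    if i == ord0 then beta j - (if j == ord0 then \sum_(k | k != ord0) alpha k else 0)
    else if j == ord0 then alpha i else 0).

(** A basis matrix changes one interior entry and repairs the margins in row 0 and column 0, so the
    interior entries are the coordinates, and the margins determine the rest. *)
Lemma affine_chart_margins (alpha : 'I_m.+1 -> R) (beta : 'I_n.+1 -> R)
    (M : 'M[R]_(m.+1, n.+1)) (u : 'rV[R]_(m * n)) :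
  (forall i, i != ord0 -> \sum_j M i j = alpha i) ->
  (forall j, \sum_i M i j = beta j) ->
  (forall r, u 0 r = M (interior_entry r).1 (interior_entry r).2) ->
  affine_chart (chart_origin alpha beta) chart_basis u = mxvec M.
Proof.
move=> rowM colM uM.
rewrite /affine_chart mulmx_sum_row /chart_origin.
rewrite (eq_bigr (fun r => mxvec (u 0 r *: (\matrix_(i, j)
    (edge_vector (mxtens_unindex r).1 i * edge_vector (mxtens_unindex r).2 j)))));
  last first.
  by move=> r _; rewrite linearZ/= rowK.
rewrite -linear_sum -linearD/=; congr mxvec; apply/matrixP => i j.
rewrite mxE summxE !mxE.
rewrite (eq_bigr (fun r => M (lift ord0 (mxtens_unindex r).1)
    (lift ord0 (mxtens_unindex r).2) *
    (edge_vector (mxtens_unindex r).1 i * edge_vector (mxtens_unindex r).2 j)));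
  last by move=> r _; rewrite mxE [X in _ * X]mxE uM.
rewrite (sum_mxtens (fun a b => M (lift ord0 a) (lift ord0 b) *
  (edge_vector a i * edge_vector b j))).
rewrite [X in _ + X](eq_bigr (fun a =>
    (if unlift ord0 j is Some b then M (lift ord0 a) (lift ord0 b)
     else - \sum_b M (lift ord0 a) (lift ord0 b)) * edge_vector a i)); last first.
  move=> a _; rewrite -(sum_edge_vector (fun b => M (lift ord0 a) (lift ord0 b))).
  by rewrite mulr_suml; apply: eq_bigr => b _; ring.
rewrite sum_edge_vector.
have Mi0 a : \sum_b M (lift ord0 a) (lift ord0 b) =
    alpha (lift ord0 a) - M (lift ord0 a) ord0.
  by rewrite -(rowM (lift ord0 a))// big_ord_recl addrC addKr.
have M0j b : \sum_a M (lift ord0 a) b = beta b - M ord0 b.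
  by rewrite -(colM b) big_ord_recl addrC addKr.
case: (unliftP ord0 i) => [a ->|->]; case: (unliftP ord0 j) => [b ->|->];
  rewrite ?eqxx/=.
- by rewrite add0r.
- by rewrite Mi0 subKr.
- by rewrite M0j subr0 subKr.
- rewrite sumrN opprK; under [X in _ + X]eq_bigr do rewrite Mi0.
  rewrite sumrB M0j.
  rewrite [X in _ - X]big_mkcond big_ord_recl/= add0r.
  by rewrite opprB addrA addrC; ring.
Qed.

End chart.

(** * Volumes of the slices with given margins *)

Section coordinates.
Context {R : realType} {m n : nat}.
Local Notation K := ('I_m.+1 * 'I_n.+1)%type.
Implicit Types (x u v p t : K -> R) (k : K).

(* The matrices with given margins are parametrized by a point [x] of [K -> R]:
   [x (i, j)] is an entry of the matrix for [i, j] nonzero, [x (i, 0)] for [i]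
   nonzero is a row sum and [x (0, j)] is a column sum.  The matrix is
   [entry ^~ x]; this linear change of variables is triangular for [level]. *)
Definition complement_sum k x : R :=
  if k.1 == ord0 then
    if k.2 == ord0 then
      \sum_(i | i != ord0) (x (i, ord0) - \sum_(j | j != ord0) x (i, j))
    else \sum_(i | i != ord0) x (i, k.2)
  else if k.2 == ord0 then \sum_(j | j != ord0) x (k.1, j) else 0.

Definition entry k x : R := x k - complement_sum k x.

(** [complement_sum k] reads only coordinates of level above that of [k]. Integrating by increasing
    level, each entry is thus a translate of its own coordinate. *)
Definition level k : nat := (k.1 != ord0) + (k.2 != ord0).

Lemma entry_interior r x : entry (interior_entry r) x = x (interior_entry r).
Proof. by rewrite /entry /complement_sum /= subr0. Qed.

Lemma entry_row i x : i != ord0 -> \sum_j entry (i, j) x = x (i, ord0).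
Proof.
move=> i0; rewrite (bigD1 ord0)//= {1}/entry /complement_sum /= (negbTE i0).
rewrite [X in _ + X](eq_bigr (fun j => x (i, j))); first by rewrite subrK.
by move=> j j0; rewrite /entry /complement_sum /= (negbTE i0) (negbTE j0) subr0.
Qed.

Lemma entry_col j x : \sum_i entry (i, j) x = x (ord0, j).
Proof.
rewrite (bigD1 ord0)//= {1}/entry /complement_sum /=.
case: eqVneq => [->|j0].
  rewrite [X in _ + X](eq_bigr (fun i => x (i, ord0) - \sum_(j | j != ord0) x (i, j))).
    by rewrite subrK.
  by move=> i i0; rewrite /entry /complement_sum /= (negbTE i0).
rewrite [X in _ + X](eq_bigr (fun i => x (i, j))); first by rewrite subrK.
by move=> i i0; rewrite /entry /complement_sum /= (negbTE i0) (negbTE j0) subr0.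
Qed.

Lemma complement_sum_upd k l x (s : R) : (level l <= level k)%N ->
  complement_sum k (upd x l s) = complement_sum k x.
Proof.
case: k l => [i j] [a b]; rewrite /level /complement_sum /= => lvl.
have updE i' j' : ((level (a, b)) < level (i', j'))%N ->
    upd x (a, b) s (i', j') = x (i', j').
  by move=> h; apply: upd_other; apply: contraTneq h => ->; rewrite ltnn.
have [i0|i0] := eqVneq i ord0; have [j0|j0] := eqVneq j ord0 => //.
- apply: eq_bigr => i' i'0; congr (_ - _).
    by apply: updE; move: lvl; rewrite /level/= i0 j0 eqxx i'0.
  apply: eq_bigr => j' j'0; apply: updE; move: lvl.
  by rewrite /level/= i0 j0 eqxx i'0 j'0 leqn0 => /eqP ->.
- apply: eq_bigr => i' i'0; apply: updE; move: lvl.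
  by rewrite /level/= i0 eqxx i'0 j0.
- apply: eq_bigr => j' j'0; apply: updE; move: lvl.
  by rewrite /level/= j0 eqxx i0 j'0.
Qed.

Lemma entry_combination k (a b : R) u v :
  entry k (fun l => a * u l + b * v l) = a * entry k u + b * entry k v.
Proof.
rewrite /entry /complement_sum; case: ifP => _; case: ifP => _; last by ring.
- rewrite [X in _ - X](_ : _ =
    a * \sum_(i | i != ord0) (u (i, ord0) - \sum_(j | j != ord0) u (i, j)) +
    b * \sum_(i | i != ord0) (v (i, ord0) - \sum_(j | j != ord0) v (i, j))).
    by ring.
  rewrite !mulr_sumr -big_split/=; apply: eq_bigr => i _.
  by rewrite big_split/= -!mulr_sumr; ring.
- by rewrite big_split/= -!mulr_sumr; ring.
- by rewrite big_split/= -!mulr_sumr; ring.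
Qed.

Lemma coord_measurable_entry k : coord_measurable (entry k).
Proof.
move=> d T phi mphi; rewrite /entry /complement_sum.
apply: measurable_funB; first exact: mphi.
have mbig (I : finType) (P : pred I) (h : I -> T -> R) :
    (forall i, measurable_fun setT (h i)) ->
    measurable_fun setT (fun z => \sum_(i | P i) h i z).
  move=> mh; rewrite (_ : (fun z => _) =
    fun z => \sum_(i <- [seq i <- index_enum I | P i]) h i z); first exact: measurable_sum.
  by apply/funext => z; rewrite big_filter.
case: (k.1 == ord0); case: (k.2 == ord0) => //; apply: (@mbig) => i; try exact: mphi.
apply: measurable_funB; first exact: mphi.
by apply: mbig => j; exact: mphi.
Qed.

Definition feasible x : bool := [forall k, 0 <= entry k x].

Definition feasible_indic x : \bar R := ((feasible x)%:R)%:E.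

Lemma feasible_indic_le1 x : (feasible_indic x <= 1)%E.
Proof. by rewrite lee_fin; case: feasible. Qed.

Lemma feasible_indic_gt0 x : (0 < feasible_indic x)%E = feasible x.
Proof. by rewrite lte_fin; case: feasible; rewrite ?ltr01 ?ltxx. Qed.

(** The feasible points form a convex set, and exponents strictly below the value 1 are negative. *)
Lemma log_concave_feasible_indic : log_concave feasible_indic.
Proof.
move=> l u v a b l01 au bv.
have Fu : feasible u.
  by rewrite -feasible_indic_gt0 (lt_trans _ au)// lte_fin expR_gt0.
have Fv : feasible v.
  by rewrite -feasible_indic_gt0 (lt_trans _ bv)// lte_fin expR_gt0.
have a0 : a < 0 by move: au; rewrite /feasible_indic Fu lte_fin /= -expR0 ltr_expR.
have b0 : b < 0 by move: bv; rewrite /feasible_indic Fv lte_fin /= -expR0 ltr_expR.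
rewrite /feasible_indic.
have -> : feasible (fun k => (1 - l) * u k + l * v k).
  apply/forallP => k; rewrite entry_combination.
  by rewrite addr_ge0// mulr_ge0 ?(forallP Fu) ?(forallP Fv)//; lra.
have /andP[l0 l1] := l01.
rewrite lee_fin /= -[leRHS]expR0 ler_expR -[leRHS]addr0.
by rewrite lerD//; apply: mulr_ge0_le0; rewrite ltW// subr_gt0.
Qed.

(** The sum of row 0 is left out because the other margins determine it. The length of this list is
    the exponent of [expR 1] in the theorem. *)
Definition margin_coords : seq K :=
  [seq (ord0, j) | j <- enum 'I_n.+1] ++ [seq (lift ord0 i, ord0) | i <- enum 'I_m].

Definition interior_coords : seq K := [seq interior_entry r | r <- enum 'I_(m * n)].

Lemma big_neq_ord0 (T : Type) (idx : T) (op : Monoid.com_law idx) q (F : 'I_q.+1 -> T) :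
  \big[op/idx]_(i | i != ord0) F i = \big[op/idx]_(i < q) F (lift ord0 i).
Proof. by rewrite big_mkcond big_ord_recl /= Monoid.mul1m. Qed.

Lemma big_margin_coords (T : Type) (idx : T) (op : Monoid.com_law idx) (F : K -> T) :
  \big[op/idx]_(k <- margin_coords) F k =
  op (\big[op/idx]_j F (ord0, j)) (\big[op/idx]_(i | i != ord0) F (i, ord0)).
Proof.
by rewrite big_cat 2!big_map !big_enum /= (big_neq_ord0 op (fun i => F (i, ord0))).
Qed.

Lemma mem_interior_coords k : (k \in interior_coords) = (level k == 2)%N.
Proof.
apply/mapP/idP => [[r _ ->]//|h].
have /interior_entryP[r ->] : (k.1 != ord0) && (k.2 != ord0).
  by move: h; rewrite /level; case: (k.1 == ord0); case: (k.2 == ord0).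
by exists r; rewrite ?mem_enum.
Qed.

Lemma mem_margin_coords k : (k \in margin_coords) = (level k < 2)%N.
Proof.
rewrite mem_cat; apply/orP/idP => [[/mapP[j _ ->]|/mapP[i _ ->]]|].
- by rewrite /level /=; case: (_ != _).
- by [].
case: k => i j; rewrite /level /=.
case: (unliftP ord0 i) => [a ->|->] h; last first.
  by left; apply/mapP; exists j; rewrite ?mem_enum.
right; apply/mapP; exists a; rewrite ?mem_enum//; congr (_, _).
by apply/eqP; move: h; case: (j == ord0).
Qed.

Lemma uniq_coords : uniq (margin_coords ++ interior_coords).
Proof.
rewrite cat_uniq; apply/and3P; split.
- rewrite cat_uniq; apply/and3P; split.
  + by rewrite map_inj_uniq ?enum_uniq// => i j /pair_equal_spec[].
  + apply/hasPn => _ /mapP[i _ ->]; apply/negP => /mapP[j _ /pair_equal_spec[/eqP]].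
    by rewrite eq_sym (negbTE (neq_lift _ _)).
  + by rewrite map_inj_uniq ?enum_uniq// => i j /pair_equal_spec[/lift_inj].
- apply/hasPn => k; rewrite mem_interior_coords => /eqP h.
  by rewrite mem_margin_coords h.
- by rewrite map_inj_uniq ?enum_uniq//; exact: interior_entry_inj.
Qed.

Lemma mem_coords k : k \in margin_coords ++ interior_coords.
Proof.
rewrite mem_cat mem_margin_coords mem_interior_coords /level.
by case: (k.1 == ord0); case: (k.2 == ord0).
Qed.

Lemma sorted_coords : sorted (relpre level leq) (margin_coords ++ interior_coords).
Proof.
have const c (s : seq K) : (forall k, k \in s -> level k = c) ->
    pairwise (relpre level leq) s.
  elim: s => //= k s IH h; rewrite IH ?andbT => [|l ls]; last by rewrite h// inE ls orbT.
  by apply/allP => l ls /=; rewrite !h ?mem_head// inE ls orbT.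
have tr : transitive (relpre level leq) by move=> ? ? ?; exact: leq_trans.
rewrite (sorted_pairwise tr) pairwise_cat; apply/and3P; split.
- apply/allrelP => k l; rewrite mem_margin_coords mem_interior_coords => + /eqP /= ->.
  exact: ltnW.
- rewrite pairwise_cat enum_ordSl /=.
  have lvl1 k : k \in [seq (ord0, lift ord0 j) | j <- enum 'I_n] -> level k = 1%N.
    by move=> /mapP[j _ ->].
  have lvl1' k : k \in [seq (lift ord0 i, ord0) | i <- enum 'I_m] -> level k = 1%N.
    by move=> /mapP[j _ ->].
  rewrite (const 1%N _ lvl1') andbT; apply/andP; split.
    apply/allrelP => k l kin /lvl1' /= ->; move: kin; rewrite inE => /predU1P[->//|].
    by rewrite -map_comp => /lvl1 ->.
  by rewrite -map_comp (const 1%N _ lvl1) andbT; apply/allP => l /lvl1 /= ->.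
- by apply: (const 2%N) => k; rewrite mem_interior_coords => /eqP.
Qed.

End coordinates.

(** * Laplace transform and capacity bound of the slice volume *)

Section section_volume.
Context {R : realType} {m n : nat}.
Local Notation K := ('I_m.+1 * 'I_n.+1)%type.
Local Notation coords := (@margin_coords m n ++ @interior_coords m n).
Implicit Types (x u v p t : K -> R) (k : K).

Lemma big_coords (T : Type) (idx : T) (op : Monoid.com_law idx) (F : K -> T) :
  \big[op/idx]_(k <- coords) F k = \big[op/idx]_i \big[op/idx]_j F (i, j).
Proof.
rewrite (pair_bigA _ (fun i j => F (i, j)))/=.
rewrite big_uniq ?uniq_coords//=; apply: eq_big => [k|[i j] _ //].
by rewrite mem_coords.
Qed.

(** The rate [s_i + t_j] of an entry, with [s_0 = 0] since row 0 has no coordinate. *)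
Definition cost t k : R := (if k.1 == ord0 then 0 else t (k.1, ord0)) + t (ord0, k.2).

Lemma sum_margin_coords t x :
  \sum_(k <- margin_coords) t k * x k = \sum_(k <- coords) cost t k * entry k x.
Proof.
rewrite big_margin_coords big_coords /cost /=.
under [RHS]eq_bigr do under eq_bigr do rewrite mulrDl.
under [RHS]eq_bigr do rewrite big_split.
rewrite big_split/= addrC; congr (_ + _); last first.
  rewrite exchange_big/=; apply: eq_bigr => j _.
  by rewrite -mulr_sumr entry_col.
rewrite [RHS](bigD1 ord0)//= [X in X + _]big1 ?add0r => [|j _]; last by rewrite mul0r.
apply: eq_bigr => i i0; rewrite (negbTE i0) -(entry_row x i0) mulr_sumr.
by [].
Qed.

Lemma expR_feasible_indic t x :
  ((expR (- \sum_(k <- margin_coords) t k * x k))%:E * feasible_indic x =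
   \big[mule/1%E]_(k <- coords) (exp_density (cost t k) (entry k x))%:E)%E.
Proof.
rewrite sum_margin_coords -(big_morph EFin (@EFinM R) erefl) /feasible_indic -EFinM.
congr EFin; have [Fx|nFx] := boolP (feasible x).
  rewrite mulr1 -sumrN expR_sum; apply: eq_bigr => k _.
  by rewrite /exp_density (forallP Fx).
rewrite mulr0; apply/esym/eqP; rewrite prodf_seq_eq0; apply/hasP.
move: nFx; rewrite negb_forall => /existsP[k kx].
by exists k; rewrite ?mem_coords//= /exp_density (negbTE kx).
Qed.

Lemma nonneg_measurable_exp_density c k :
  nonneg_measurable (fun x => (exp_density c (entry k x))%:E).
Proof.
split => [x|d T phi mphi]; first by rewrite lee_fin exp_density_ge0.
apply/measurable_EFinP; apply: measurableT_comp; first exact: measurable_exp_density.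
exact: coord_measurable_entry.
Qed.

Lemma nonneg_measurable_feasible_indic :
  nonneg_measurable (@feasible_indic R m n).
Proof.
rewrite (_ : feasible_indic = fun x =>
  \big[mule/1%E]_(k <- coords) (exp_density (cost (fun=> 0) k) (entry k x))%:E).
  by apply: nonneg_measurable_prod => k _; exact: nonneg_measurable_exp_density.
apply/funext => x; rewrite -expR_feasible_indic.
by rewrite big1 ?oppr0 ?expR0 ?mul1e// => k _; rewrite mul0r.
Qed.

(** The value [+oo] records the divergent integrals, so that the product formula holds for every
    [t]. *)
Definition laplace_factor (c : R) : \bar R := if 0 < c then (c^-1)%:E else +oo%E.

Lemma laplace_feasible_indic t p :
  marginals coords (fun x => (expR (- \sum_(k <- margin_coords) t k * x k))%:E *
    feasible_indic x)%E p =
  \big[mule/1%E]_(k <- coords) laplace_factor (cost t k).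
Proof.
rewrite (_ : (fun x => _) = fun x =>
    \big[mule/1%E]_(k <- coords) (exp_density (cost t k) (entry k x))%:E);
  last by apply/funext => x; exact: expR_feasible_indic.
apply: (marginals_prod (rk := @level m n)).
- exact: uniq_coords.
- exact: sorted_coords.
- by move=> k _; exact: nonneg_measurable_exp_density.
- move=> i j x s _ _ ij lij; rewrite /entry complement_sum_upd//.
  by rewrite upd_other// eq_sym.
- move=> i x _; rewrite /marginal /laplace_factor.
  under eq_integral do rewrite /entry complement_sum_upd// upd_same.
  case: ltP => c0; first exact: integral_exp_density.
  exact: integral_exp_density_infty.
Qed.

Lemma prode_gt0 (I : Type) (s : seq I) (F : I -> \bar R) :
  (forall i, 0 < F i)%E -> (0 < \big[mule/1%E]_(i <- s) F i)%E.
Proof.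
by move=> F0; elim/big_rec: _ => [|i y _ y0]; [exact: lte01|exact: mule_gt0].
Qed.

Lemma prode_pinfty (I : eqType) (s : seq I) (F : I -> \bar R) i :
  (forall i, 0 < F i)%E -> i \in s -> F i = +oo%E ->
  \big[mule/1%E]_(i <- s) F i = +oo%E.
Proof.
move=> F0; elim: s => // j s IH; rewrite inE big_cons => /predU1P[<-|is_] Fi.
  by rewrite Fi gt0_mulye// prode_gt0.
by rewrite IH// gt0_muley.
Qed.

Lemma laplace_factor_gt0 c : (0 < laplace_factor c)%E.
Proof. by rewrite /laplace_factor; case: ifP => // c0; rewrite lte_fin invr_gt0. Qed.

(** The constant is governed by the corner entry: one coordinate, minus a sum of at most [m.+1]
    terms, each a coordinate minus at most [n.+1] others. *)
Lemma entry_dist k x p (e : R) : (forall l, `|x l - p l| < e) ->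
  `|entry k x - entry k p| <= (1 + m.+1%:R * (1 + n.+1%:R)) * e.
Proof.
move=> xp.
have e0 : 0 <= e by apply: (le_trans (normr_ge0 _) (ltW (xp k))).
have sum_dist q (P : pred 'I_q) (f g : 'I_q -> R) (c : R) : 0 <= c ->
    (forall i, `|f i - g i| <= c) ->
    `|\sum_(i | P i) f i - \sum_(i | P i) g i| <= q%:R * c.
  move=> c0 fg; rewrite -sumrB; apply: (le_trans (ler_norm_sum _ _ _)).
  apply: (@le_trans _ _ (\sum_(i < q) c)).
    by rewrite big_mkcond; apply: ler_sum => i _; case: ifP.
  by rewrite sumr_const card_ord mulr_natl.
have dist_le c d (a b y z : R) : `|a - b| <= c -> `|y - z| <= d ->
    `|(a - y) - (b - z)| <= c + d.
  move=> ab yz; rewrite (_ : _ - _ = (a - b) - (y - z)); last by ring.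
  by apply: (le_trans (ler_normB _ _)); rewrite lerD.
rewrite mulrDl mul1r; apply: (@dist_le); first exact: ltW.
have m0 : 0 <= m.+1%:R * (n.+1%:R * e) by rewrite !mulr_ge0.
have n0 : 0 <= n.+1%:R * e by rewrite mulr_ge0.
have me : 0 <= m.+1%:R * e by rewrite mulr_ge0.
have n1e : n.+1%:R * e <= m.+1%:R * (n.+1%:R * e) by rewrite ler_peMl// ler1n.
rewrite -mulrA mulrDl mul1r /complement_sum.
case: (k.1 == ord0); case: (k.2 == ord0).
- apply: (@sum_dist); first exact: addr_ge0.
  move=> i; apply: (@dist_le); first exact: ltW.
  by apply: (@sum_dist) => // j; exact: ltW.
- apply: (@le_trans _ _ (m.+1%:R * e)); last by rewrite ler_pM2l// lerDl.
  by apply: (@sum_dist) => // i; exact: ltW.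
- apply: (@le_trans _ _ (n.+1%:R * e)); last by rewrite mulrDr (le_trans n1e)// lerDr.
  by apply: (@sum_dist) => // i; exact: ltW.
- by rewrite subrr normr0 mulr_ge0// addr_ge0.
Qed.

Lemma feasible_near p : (forall k, 0 < entry k p) ->
  exists2 e : R, 0 < e & forall x, (forall k, `|x k - p k| < e) -> feasible x.
Proof.
move=> p0; pose C : R := 1 + m.+1%:R * (1 + n.+1%:R).
have C0 : 0 < C by rewrite addr_gt0// mulr_gt0// addr_gt0.
pose k0 := [arg min_(k < (ord0, ord0) : K) entry k p]%O.
have k0min k : entry k0 p <= entry k p by rewrite /k0; case: arg_minP => // i _; apply.
exists (entry k0 p / C); first exact: divr_gt0.
move=> x xp; apply/forallP => k.
have := entry_dist k xp; rewrite -/C mulrC divfK ?gt_eqF//.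
by rewrite ler_norml => /andP[h _]; have := k0min k; lra.
Qed.

(** The interior coordinates of [p] are integrated out, so this is a function of the margins. *)
Definition section_volume p : \bar R := marginals interior_coords (@feasible_indic R m n) p.

Lemma feasible_margin_ge0 x k : feasible x -> k \in margin_coords -> 0 <= x k.
Proof.
move=> /forallP Fx; rewrite mem_cat => /orP[/mapP[j _ ->]|/mapP[i _ ->]].
- by rewrite -entry_col sumr_ge0.
- by rewrite -entry_row// sumr_ge0.
Qed.

(** An interior entry is at most its column sum, so a single box covers the slice. *)
Lemma section_volume_lt_pinfty p : (forall k, 0 < entry k p) ->
  (section_volume p < +oo)%E.
Proof.
move=> p0; apply: (@le_lt_trans _ _ (\esum_(l in [set 0%N])
  (\prod_(k <- @interior_coords m n) (p (ord0, k.2) - 0))%:E)%E).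
  apply: (@marginals_le_cover _ _ _ _ _ _ (fun _ _ => 0) (fun _ k => p (ord0, k.2))).
  - by have := @uniq_coords m n; rewrite cat_uniq => /and3P[].
  - exact: nonneg_measurable_feasible_indic.
  - by move=> _ k _; rewrite -entry_col sumr_ge0// => i _; exact: ltW.
  - exact: feasible_indic_le1.
  - move=> x xp; rewrite feasible_indic_gt0 => Fx; exists 0%N => // k.
    move=> /mapP[r _ kr]; rewrite kr -(entry_interior r) -kr (forallP Fx)/=.
    rewrite -xp; last by rewrite mem_interior_coords /level/=; case: (k.2 == ord0).
    rewrite -entry_col (bigD1 k.1)//= -surjective_pairing lerDl sumr_ge0// => i _.
    exact: (forallP Fx).
rewrite esum_set1 ?ltry// lee_fin prodr_ge0// => k _; rewrite subr0.
by rewrite -entry_col sumr_ge0// => i _; exact: ltW.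
Qed.

Lemma section_volume_capacity p : (forall k, 0 < entry k p) ->
  exists t, (forall k, 0 < cost t k) /\
    ((expR (\sum_(k <- margin_coords) t k * p k) * \prod_(k <- coords) (cost t k)^-1)%:E
     <= (expR 1 ^+ (m + n).+1 * \prod_(k <- margin_coords) p k)%:E * section_volume p)%E.
Proof.
move=> p0; have [e e0 pe] := feasible_near p0.
have mf := nonneg_measurable_feasible_indic.
have us := @uniq_coords m n.
have [um _ ui] := and3P (etrans (esym (cat_uniq _ _)) us).
have p_margin k : k \in @margin_coords m n -> 0 < p k.
  rewrite mem_cat => /orP[/mapP[j _ ->]|/mapP[i _ ->]].
  - by rewrite -entry_col big_ord_recl ltr_wpDr// sumr_ge0// => i _; exact: ltW.
  - by rewrite -entry_row// big_ord_recl ltr_wpDr// sumr_ge0// => j _; exact: ltW.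
have notin k l : k \in @margin_coords m n -> l \in @interior_coords m n -> k != l.
  rewrite mem_margin_coords mem_interior_coords => + /eqP l2.
  by apply: contraTneq => ->; rewrite l2.
(* Integrating over the interior does not move the margins, and no feasible point has a negative
   one. *)
have Fneg x k : k \in @margin_coords m n -> x k < 0 -> section_volume x = 0%E.
  move=> km xk; apply/eqP; rewrite eq_le; apply/andP; split; last first.
    by have [] := nonneg_measurable_marginals (@interior_coords m n) mf.
  rewrite (_ : 0%E = marginals (@interior_coords m n) (fun x => 0 * feasible_indic x)%E x).
    apply: le_marginals => //.
      apply: nonneg_measurableM => //; exact: nonneg_measurable_cst.
    move=> y yx; rewrite mul0e leNgt feasible_indic_gt0; apply/negP => Fy.
    have := feasible_margin_ge0 Fy km; rewrite yx ?leNgt ?xk//.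
    by apply/negP => /(notin _ _ km); rewrite eqxx.
  by rewrite marginalsZl// mul0e.
have Fpos x : (forall k, `|x k - p k| < e) -> (0 < section_volume x)%E.
  move: x; apply: marginals_gt0 => // x /pe.
  by rewrite -feasible_indic_gt0.
have mF : nonneg_measurable section_volume by exact: nonneg_measurable_marginals.
have lF : log_concave section_volume.
  by apply: log_concave_marginals => //; exact: log_concave_feasible_indic.
have [t ht] := log_concave_capacity um mF lF Fneg p_margin (section_volume_lt_pinfty p0) e0 Fpos.
exists t.
pose C := expR (\sum_(k <- margin_coords) t k * p k).
pose G x := ((expR (- \sum_(k <- margin_coords) t k * x k))%:E)%E.
have G0 x : (0 <= G x)%E by rewrite lee_fin expR_ge0.
have mG : nonneg_measurable G.
  apply: nonneg_measurable_expR => d T phi mphi.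
  apply: measurable_funN; apply: measurable_sum => k.
  by apply: measurable_funM => //; exact: mphi.
have lapl : (C%:E * \big[mule/1%E]_(k <- coords) laplace_factor (cost t k) <=
    (expR 1 ^+ (m + n).+1 * \prod_(k <- margin_coords) p k)%:E * section_volume p)%E.
  have -> : (m + n).+1 = size (@margin_coords m n).
    by rewrite size_cat addnC -addSn; congr addn; rewrite size_map size_enum_ord.
  move: ht.
  apply: le_trans; rewrite le_eqVlt; apply/orP; left; apply/eqP.
  rewrite (_ : (fun x => _) = fun x => C%:E * (G x * section_volume x))%E; last first.
    apply/funext => x; rewrite muleA -EFinM -expRD; congr ((expR _)%:E * _)%E.
    by rewrite -sumrN -sumrN -big_split/=; apply: eq_bigr => k _; ring.
  rewrite marginalsZl//; last 2 first.
  - apply: nonneg_measurableM => //; exact: nonneg_measurable_marginals.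
  - by move=> x; rewrite lee_fin expR_ge0.
  congr (_ * _)%E.
  (* The weight [G] depends on the margins alone, so it passes under the interior integrals. *)
  rewrite (_ : (fun x => G x * _)%E =
      marginals (@interior_coords m n) (fun x => G x * feasible_indic x)%E); last first.
    rewrite marginalsZl// => x k s ki; rewrite /G; congr (expR (- _))%:E.
    by apply: eq_big_seq => l lm; rewrite upd_other// notin.
  (* The slice volume integrates the interior first, whereas the product formula starts with the
     margins. *)
  rewrite -marginals_cat marginals_catC ?laplace_feasible_indic//.
  exact: nonneg_measurableM.
have rhs_fin : ((expR 1 ^+ (m + n).+1 * \prod_(k <- margin_coords) p k)%:E *
    section_volume p < +oo)%E.
  have := section_volume_lt_pinfty p0.
  have : (0 < section_volume p)%E by apply: Fpos => k; rewrite subrr normr0.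
  by case: (section_volume p) => // r _ _; rewrite -EFinM ltry.
(* One nonpositive rate would make the whole product [+oo], against the finite right-hand side. *)
have cost0 k : 0 < cost t k.
  rewrite ltNge; apply/negP => ck; move: (le_lt_trans lapl rhs_fin).
  rewrite (prode_pinfty (i := k)) ?mem_coords//.
  - by rewrite gt0_muley ?lte_fin ?expR_gt0.
  - by move=> i; exact: laplace_factor_gt0.
  - by rewrite /laplace_factor ltNge ck.
split => //; apply: le_trans lapl; rewrite EFinM.
rewrite (big_morph EFin (@EFinM R) erefl) (eq_bigr (fun k => laplace_factor (cost t k)))//.
by move=> k _; rewrite /laplace_factor cost0.
Qed.

End section_volume.

(** * Slice volume against polytope volume *)

Section transportation.
Context {R : realType} {m n : nat}.
Local Notation K := ('I_m.+1 * 'I_n.+1)%type.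
Context (alpha : 'I_m.+1 -> nat) (beta : 'I_n.+1 -> nat).
Context (margins_eq : (\sum_i alpha i = \sum_j beta j)%N).

Let total : R := \sum_j (beta j)%:R.

Let sum_alpha : \sum_i (alpha i)%:R = total.
Proof. by rewrite /total -!natr_sum margins_eq. Qed.

(** The coordinates of the rank-one matrix [alpha i * beta j / total], an explicit point with
    positive entries when all margins are positive. *)
Definition product_point (k : K) : R :=
  if k.1 == ord0 then (beta k.2)%:R
  else if k.2 == ord0 then (alpha k.1)%:R
  else (alpha k.1)%:R * (beta k.2)%:R / total.

Lemma entry_product_point k : total != 0 ->
  entry k product_point = (alpha k.1)%:R * (beta k.2)%:R / total.
Proof.
move=> t0.
have sa : \sum_(i | i != ord0) (alpha i)%:R = total - (alpha ord0)%:R.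
  by rewrite -sum_alpha [in RHS](bigD1 ord0)//= addrAC subrr add0r.
have sb : \sum_(j | j != ord0) (beta j)%:R = total - (beta ord0)%:R.
  by rewrite /total [in RHS](bigD1 ord0)//= addrAC subrr add0r.
case: k => i j; rewrite /entry /complement_sum /=.
have rowE a : a != ord0 -> \sum_(b | b != ord0) product_point (a, b) =
    (alpha a)%:R * (total - (beta ord0)%:R) / total.
  move=> a0; rewrite -sb mulr_sumr mulr_suml; apply: eq_bigr => b b0.
  by rewrite /product_point /= (negbTE a0) (negbTE b0).
have [->|i0] := eqVneq i ord0; have [->|j0] := eqVneq j ord0.
- rewrite (eq_bigr (fun a => (alpha a)%:R * ((beta ord0)%:R / total))).
    by rewrite -mulr_suml sa /product_point /=; field.
  by move=> a a0; rewrite rowE// /product_point /= (negbTE a0) /=; field.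
- rewrite (eq_bigr (fun a => (alpha a)%:R * ((beta j)%:R / total))).
    by rewrite -mulr_suml sa /product_point /=; field.
  by move=> a a0; rewrite /product_point /= (negbTE a0) (negbTE j0) mulrA.
- by rewrite rowE// /product_point /= (negbTE i0) /=; field.
- by rewrite subr0 /product_point /= (negbTE i0) (negbTE j0).
Qed.

Let origin : 'rV[R]_(m.+1 * n.+1) :=
  chart_origin (fun i => (alpha i)%:R) (fun j => (beta j)%:R).

Let chart := affine_chart origin (@chart_basis R m n).

Lemma feasible_polytope (x : K -> R) :
  (forall k, k \notin interior_coords -> x k = product_point k) -> feasible x ->
  transportation_polytope alpha beta (\matrix_(i, j) entry (i, j) x).
Proof.
move=> xp Fx.
have row_sum i : i != ord0 -> \sum_j entry (i, j) x = (alpha i)%:R.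
  move=> i0; rewrite entry_row// xp.
    by rewrite /product_point /= (negbTE i0).
  by rewrite mem_interior_coords /level /=; case: (i != ord0).
have col_sum j : \sum_i entry (i, j) x = (beta j)%:R.
  by rewrite entry_col xp// mem_interior_coords /level /=; case: (j != ord0).
split=> [i j|i|j].
- by rewrite mxE (forallP Fx).
- under eq_bigr do rewrite mxE.
  have [->|] := eqVneq i ord0; last exact: row_sum.
  (* Row 0 has no coordinate of its own; its sum is what the other rows leave of the total. *)
  have : \sum_i \sum_j entry (i, j) x = total.
    by rewrite exchange_big; apply: eq_bigr => j _; exact: col_sum.
  rewrite -sum_alpha (bigD1 ord0)//= [in RHS](bigD1 ord0)//=.
  by rewrite (eq_bigr _ row_sum) => /addIr.
- by under eq_bigr do rewrite mxE.
Qed.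

Lemma section_volume_le_outer :
  (section_volume product_point <=
   lebesgue_outer (chart @^-1` (mxvec @` transportation_polytope alpha beta)))%E.
Proof.
apply: le_ereal_inf_tmp => _ [N [a [b [ab cover ->]]]].
(* Corners of boxes are transported to functions on [K]; the value 0 off the interior entries is a
   mere default. *)
pose ext (c : nat -> 'rV[R]_(m * n)) l (k : K) : R :=
  if [pick r | interior_entry r == k] is Some r then c l 0 r else 0.
have extE c l r : ext c l (interior_entry r) = c l 0 r.
  rewrite /ext; case: pickP => [s /eqP/interior_entry_inj ->//|/(_ r)].
  by rewrite eqxx.
rewrite (eq_esum (b := fun l =>
    (\prod_(k <- @interior_coords m n) (ext b l k - ext a l k))%:E)); last first.
  move=> l _; rewrite big_map big_enum/=; congr EFin.
  by apply: eq_bigr => r _; rewrite !extE.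
apply: marginals_le_cover.
- by have := @uniq_coords m n; rewrite cat_uniq => /and3P[].
- exact: nonneg_measurable_feasible_indic.
- by move=> l _ /mapP[r _ ->]; rewrite !extE.
- exact: feasible_indic_le1.
move=> x xp; rewrite feasible_indic_gt0 => Fx.
have Px := feasible_polytope xp Fx.
pose u : 'rV[R]_(m * n) := \row_r x (interior_entry r).
have chart_u : chart u = mxvec (\matrix_(i, j) entry (i, j) x).
  case: Px => _ rowP colP; apply: affine_chart_margins => // r.
  by rewrite !mxE -surjective_pairing entry_interior.
have [|l Nl ul] := cover u.
  by rewrite /preimage/= chart_u; exists (\matrix_(i, j) entry (i, j) x).
exists l => // _ /mapP[r _ ->]; rewrite !extE.
by have := ul r; rewrite mxE.
Qed.

(** The volume is a supremum over charts, so a single chart bounds it from below. *)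
Lemma section_volume_le_volume :
  ((Num.sqrt (m.+1%:R ^+ n * n.+1%:R ^+ m))%:E * section_volume product_point <=
   transportation_volume R alpha beta)%E.
Proof.
apply: (@le_trans _ _ ((Num.sqrt (\det (@chart_basis R m n *m chart_basis^T)))%:E *
  lebesgue_outer (chart @^-1` (mxvec @` transportation_polytope alpha beta)))%E).
  rewrite det_chart_basis; apply: lee_wpmul2l; first by rewrite lee_fin sqrtr_ge0.
  exact: section_volume_le_outer.
rewrite /transportation_volume !subn1 /=; apply: ereal_sup_ubound.
exists origin, chart_basis; split=> //; first exact: row_free_chart_basis.
move=> _ [M [_ rowM colM] <-].
exists (\row_r M (interior_entry r).1 (interior_entry r).2) => //.
by apply: affine_chart_margins => // r; rewrite mxE.
Qed.

End transportation.

(** * The capacity bound *)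

Section capacity_bound.
Context {R : realType} {m n : nat}.
Local Notation K := ('I_m.+1 * 'I_n.+1)%type.
Context (alpha : 'I_m.+1 -> nat) (beta : 'I_n.+1 -> nat).
Context (margins_eq : (\sum_i alpha i = \sum_j beta j)%N).

Definition capacity_term (x : 'I_m.+1 -> R) (y : 'I_n.+1 -> R) : R :=
  (\prod_i (x i ^- alpha i)) * (\prod_j (y j ^- beta j)) *
  \prod_i \prod_j (-1 / ln (x i * y j)).

Definition capacity_values : set R :=
  [set capacity_term x y | x in open_unit_cube (R:=R) (m:=m.+1) &
                           y in open_unit_cube (R:=R) (m:=n.+1)].

Lemma capacity_term_ge0 x y : open_unit_cube x -> open_unit_cube y ->
  0 <= capacity_term x y.
Proof.
move=> hx hy; have x0 i : 0 < x i by have /andP[] := hx i.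
have y0 j : 0 < y j by have /andP[] := hy j.
rewrite !mulr_ge0 ?prodr_ge0// => i _.
- by rewrite invr_ge0 exprn_ge0// ltW.
- by rewrite invr_ge0 exprn_ge0// ltW.
- rewrite prodr_ge0// => j _; rewrite mulN1r oppr_ge0 invr_le0 ln_le0//.
  have /andP[_ x1] := hx i; have /andP[_ y1] := hy j.
  by rewrite mulr_ile1 ?ltW.
Qed.

Lemma inf_capacity_le x y : open_unit_cube x -> open_unit_cube y ->
  inf capacity_values <= capacity_term x y.
Proof.
move=> hx hy; apply: ge_inf; last by exists x => //; exists y.
by exists 0 => _ [a ha [b hb <-]]; exact: capacity_term_ge0.
Qed.

Lemma capacity_term_expR (a : 'I_m.+1 -> R) (b : 'I_n.+1 -> R) :
  capacity_term (fun i => expR (- a i)) (fun j => expR (- b j)) =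
  expR (\sum_i a i * (alpha i)%:R + \sum_j b j * (beta j)%:R) *
  \prod_i \prod_j (a i + b j)^-1.
Proof.
rewrite /capacity_term expRD !expR_sum; congr (_ * _ * _).
- by apply: eq_bigr => i _; rewrite -expRM_natr -expRN mulNr opprK.
- by apply: eq_bigr => j _; rewrite -expRM_natr -expRN mulNr opprK.
- apply: eq_bigr => i _; apply: eq_bigr => j _.
  by rewrite -expRD expRK -opprD invrN mulN1r opprK.
Qed.

Lemma expRN_open_unit_cube q (a : 'I_q -> R) : (forall i, 0 < a i) ->
  open_unit_cube (fun i => expR (- a i)).
Proof. by move=> a0 i; rewrite expR_gt0 expR_lt1 oppr_lt0 a0. Qed.

(* Sending [x ord0] to [0] sends the capacity terms to [0]. *)
Lemma inf_capacity_degenerate : alpha ord0 = 0%N -> inf capacity_values <= 0.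
Proof.
move=> alpha0; rewrite leNgt; apply/negP => inf0.
(* These are the exponents of [x ord0 = expR (- s)] and [x i = expR (- 1)] for the other [i]. *)
pose a (s : R) (i : 'I_m.+1) := if i == ord0 then s else 1.
pose C := expR (\sum_(i | i != ord0) (alpha i)%:R + \sum_j (beta j)%:R) : R.
have C0 : 0 < C by exact: expR_gt0.
have bound s : 1 <= s -> inf capacity_values <= C / s.
  move=> s1; have s0 : 0 < s by lra.
  have as0 i : 0 < a s i by rewrite /a; case: ifP.
  apply: (le_trans (inf_capacity_le (expRN_open_unit_cube as0)
    (expRN_open_unit_cube (a := fun=> 1) (fun=> ltr01)))).
  rewrite capacity_term_expR.
  rewrite (_ : _ + _ = \sum_(i | i != ord0) (alpha i)%:R + \sum_j (beta j)%:R :> R); last first.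
    congr (_ + _); last by apply: eq_bigr => j _; rewrite mul1r.
    rewrite (bigD1 ord0)//= alpha0 mulr0 add0r; apply: eq_bigr => i i0.
    by rewrite /a (negbTE i0) mul1r.
  rewrite -/C ler_pM2l//.
  have inv1 i : 0 <= (a s i + 1)^-1 <= 1.
    have h : 1 <= a s i + 1 by rewrite lerDr ltW.
    by rewrite invr_ge0 (le_trans ler01)//= invf_le1// (lt_le_trans ltr01).
  (* One factor of row 0 supplies the decay [1 / s]; all others are at most 1. *)
  rewrite (bigD1 ord0)//= big_ord_recl -mulrA -[leRHS]mulr1.
  apply: ler_pM.
  - by have /andP[] := inv1 ord0.
  - rewrite mulr_ge0//; apply: prodr_ge0 => i _; last apply: prodr_ge0 => j _;
      by [have /andP[] := inv1 ord0|have /andP[] := inv1 i].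
  - by rewrite lef_pV2 ?posrE// /a eqxx ?addr_gt0//; lra.
  - rewrite mulr_ile1//; last 2 first.
    + by apply: prodr_ile1 => i _; exact: inv1.
    + apply: prodr_ile1 => i _; apply/andP; split.
        by apply: prodr_ge0 => j _; have /andP[] := inv1 i.
      by apply: prodr_ile1 => j _; exact: inv1.
    + by apply: prodr_ge0 => j _; have /andP[] := inv1 ord0.
    + apply: prodr_ge0 => i _; apply: prodr_ge0 => j _; by have /andP[] := inv1 i.
set c := inf capacity_values in inf0 bound.
(* At [s = 1 + C / c] the bound reads [c + C <= C], contrary to [0 < c]. *)
have s1 : 1 <= 1 + C / c by rewrite lerDl divr_ge0 ?ltW.
have s0 : 0 < 1 + C / c by lra.
have := bound _ s1; rewrite ler_pdivlMr// mulrDr mulr1 mulrC divfK ?gt_eqF//.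
by lra.
Qed.

Lemma inf_capacity_le_section_volume : (0 < alpha ord0)%N ->
  (forall i, i != ord0 -> (0 < alpha i)%N) -> (forall j, (0 < beta j)%N) ->
  ((inf capacity_values)%:E <=
   (expR 1 ^+ (m + n).+1 * ((\prod_j (beta j)%:R) *
     \prod_(i | i != ord0) (alpha i)%:R))%:E *
   section_volume (product_point (R := R) alpha beta))%E.
Proof.
move=> alpha0 alpha_gt0 beta_gt0.
have total0 : 0 < \sum_j (beta j)%:R :> R.
  by rewrite big_ord_recl ltr_pwDl ?ltr0n// sumr_ge0.
have p0 k : 0 < entry k (product_point (R := R) alpha beta).
  rewrite entry_product_point ?gt_eqF//.
  rewrite divr_gt0// mulr_gt0// ltr0n; last exact: beta_gt0.
  by have [->|] := eqVneq k.1 ord0; last exact: alpha_gt0.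
have [t [ct ht]] := section_volume_capacity p0.
pose s i : R := if i == ord0 then 0 else t (i, ord0).
pose r j : R := t (ord0, j).
pose i0 := [arg min_(i < ord0) s i]%O; pose j0 := [arg min_(j < ord0) r j]%O.
have si i : s i0 <= s i by rewrite /i0; case: arg_minP => // k _; apply.
have rj j : r j0 <= r j by rewrite /j0; case: arg_minP => // k _; apply.
have sr : 0 < s i0 + r j0 by exact: (ct (i0, j0)).
(* This shift makes both minima equal to [(s i0 + r j0) / 2], which is positive. *)
pose d := (r j0 - s i0) / 2.
have a0 i : 0 < s i + d by have := si i; rewrite /d; lra.
have b0 j : 0 < r j - d by have := rj j; rewrite /d; lra.
have := inf_capacity_le (expRN_open_unit_cube a0) (expRN_open_unit_cube b0).
rewrite -lee_fin => /le_trans; apply.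
rewrite [X in (_ <= X%:E * _)%E](_ : _ = expR 1 ^+ (m + n).+1 *
  \prod_(k <- margin_coords) product_point alpha beta k); last first.
  rewrite big_margin_coords; congr (_ * (_ * _)); apply: eq_bigr => i // ni.
  by rewrite /product_point /= (negbTE ni).
apply: le_trans ht; rewrite lee_fin capacity_term_expR le_eqVlt; apply/orP; left; apply/eqP.
congr (expR _ * _); last first.
  rewrite big_coords; apply: eq_bigr => i _; apply: eq_bigr => j _.
  by rewrite /cost -/(s i) -/(r j); congr (_^-1); rewrite addrACA subrr addr0.
rewrite big_margin_coords /=.
under eq_bigr do rewrite mulrDl.
under [X in _ + X]eq_bigr do rewrite mulrBl.
(* The two contributions of [d] cancel because the row and column margins have equal totals. *)
rewrite big_split sumrB -!mulr_sumr -!natr_sum margins_eq addrACA subrr addr0 addrC.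
congr (_ + _); rewrite (bigD1 ord0)//= {1}/s eqxx mul0r add0r.
by apply: eq_bigr => i ni; rewrite /s /product_point /= (negbTE ni).
Qed.

End capacity_bound.

Theorem theorem8p2 (R : realType) (m n : nat) (hm : (0 < m)%N) (hn : (0 < n)%N)
    (alpha : 'I_m -> nat) (beta : 'I_n -> nat)
    (hsum : (\sum_(i < m) alpha i = \sum_(j < n) beta j)%N)
    (halpha : forall i : 'I_m, (0 < i)%N -> (0 < alpha i)%N)
    (hbeta : forall j : 'I_n, (0 < beta j)%N) :
  ((Num.sqrt (m%:R ^+ (n - 1) * n%:R ^+ (m - 1)) / expR 1 ^+ (m + n - 1)
      * (\prod_(i < m | (0 < i)%N) (1 / (alpha i)%:R))
      * (\prod_(j < n) (1 / (beta j)%:R))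
      * inf [set (\prod_(i < m) (x i ^- alpha i))
                 * (\prod_(j < n) (y j ^- beta j))
                 * \prod_(i < m) \prod_(j < n) (-1 / ln (x i * y j))
            | x in @open_unit_cube R m & y in @open_unit_cube R n])%:E
   <= transportation_volume R alpha beta)%E.
Proof.
case: m hm alpha halpha hsum => // m _ alpha halpha hsum.
case: n hn beta hbeta hsum => // n _ beta hbeta hsum.
have alpha_gt0 i : i != ord0 -> (0 < alpha i)%N.
  by move=> i0; apply: halpha; rewrite lt0n.
apply: le_trans (section_volume_le_volume (R := R) hsum).
rewrite -/(capacity_term alpha beta) -/(capacity_values alpha beta).
have -> : \prod_(i < m.+1 | (0 < i)%N) (1 / (alpha i)%:R) =
    (\prod_(i | i != ord0) (alpha i)%:R)^-1 :> R.
  by rewrite -prodfV; apply: eq_big => [i|i _]; rewrite ?lt0n// div1r.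
have -> : \prod_(j < n.+1) (1 / (beta j)%:R) = (\prod_j (beta j)%:R)^-1 :> R.
  by rewrite -prodfV; apply: eq_bigr => i _; rewrite div1r.
rewrite !subn1 /= addnS /=.
set A := \prod_(i | _) _; set B := \prod_j _; set e := expR 1 ^+ _.
set S := Num.sqrt _; set V := section_volume _; set I := inf _.
have A0 : 0 < A by apply: prodr_gt0 => i i0; rewrite ltr0n alpha_gt0.
have B0 : 0 < B by apply: prodr_gt0 => j _; rewrite ltr0n hbeta.
have e0 : 0 < e by rewrite exprn_gt0 ?expR_gt0.
have S0 : 0 <= S by exact: sqrtr_ge0.
have V0 : (0 <= V)%E.
  have [V0 _] := nonneg_measurable_marginals (@interior_coords m n)
    (nonneg_measurable_feasible_indic (R := R)).
  exact: V0.
(* If [alpha ord0] is 0, row 0 vanishes on the polytope and no point has positive entries; the left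
   side is then at most 0. *)
have [alpha0|alpha0] := posnP (alpha ord0).
  apply: (@le_trans _ _ 0%E); last by rewrite mule_ge0.
  rewrite lee_fin mulr_ge0_le0//; last exact: inf_capacity_degenerate.
  by rewrite !mulr_ge0// invr_ge0 ltW.
have I_le : (I%:E <= (e * (B * A))%:E * V)%E by exact: inf_capacity_le_section_volume.
rewrite (_ : S / e / A / B * I = S * ((e * (B * A))^-1 * I)); last first.
  by field; rewrite !gt_eqF.
rewrite EFinM lee_wpmul2l// EFinM lee_pdivrMl// !mulr_gt0//.
Qed.
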